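(* Let $\alpha,\beta\in\Delta$. If $(\alpha|\beta)<0$, then $[x,y]\neq 0$ for all nonzero $x\in\mathfrak g_\alpha$ and $y\in\mathfrak g_\beta$ such that $\mathbb C x\neq\mathbb C y$.
   Context: Let $A=(a_{ij})_{i,j\in I}$ be a symmetrisable generalised Cartan matrix (GCM) indexed by a finite set $I$, and let $\mathfrak g(A)$ be the associated complex Kac–Moody algebra, with Cartan subalgebra $\mathfrak h$, simple roots $\alpha_i\in\mathfrak h^*$ and simple coroots $\alpha_i^\vee\in\mathfrak h$ ($i\in I$), and Chevalley generators $e_i,f_i$. It has the root space decomposition $\mathfrak g(A)=\mathfrak h\oplus\bigoplus_{\alpha\in\Delta}\mathfrak g_\alpha$, where $\mathfrak g_\alpha=\{x:[h,x]=\alpha(h)x\ \forall h\in\mathfrak h\}$ and $\Delta$ is the set of roots (nonzero $\alpha\in\mathfrak h^*$ with $\mathfrak g_\alpha\neq 0$). Let $(\cdot|\cdot)$ be the standard nondegenerate symmetric invariant bilinear form on $\mathfrak g(A)$; its restriction to $\mathfrak h$ is nondegenerate and induces a symmetric bilinear form $(\alpha,\beta)\mapsto(\alpha|\beta)$ on $\mathfrak h^*$. *)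

(* Defs.v *)
From HB Require Import structures.
From mathcomp Require Import all_boot all_order all_algebra.
From mathcomp Require Import reals complex.
Set Implicit Arguments. Unset Strict Implicit. Unset Printing Implicit Defensive.
Import Order.TTheory GRing.Theory Num.Theory.
Local Open Scope ring_scope.
Local Open Scope complex_scope.

Definition is_GCM (n : nat) (A : 'M[int]_n) : Prop :=
  (forall i, A i i = 2%:Z) /\
  (forall i j, i != j -> A i j <= 0) /\
  (forall i j, A i j = 0 <-> A j i = 0).

(* A = D B with D = diag(eps) positive, B symmetric (Kac, 2.1) *)
Definition symmetrisable (n : nat) (A : 'M[int]_n) : Prop :=
  exists eps : 'I_n -> rat, (forall i, 0 < eps i) /\
    (forall i j, (A i j)%:~R / eps i = (A j i)%:~R / eps j :> rat).

Definition is_lie_bracket (K : fieldType) (V : lmodType K) (br : V -> V -> V) : Prop :=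
  (forall (a : K) x y z, br (a *: x + y) z = a *: br x z + br y z) /\
  (forall (a : K) x y z, br z (a *: x + y) = a *: br z x + br z y) /\
  (forall x, br x x = 0) /\
  (forall x y z, br x (br y z) + br y (br z x) + br z (br x y) = 0).

Definition subspace (K : fieldType) (V : lmodType K) (S : V -> Prop) : Prop :=
  S 0 /\ (forall (a : K) x y, S x -> S y -> S (a *: x + y)).

Definition lie_ideal (K : fieldType) (V : lmodType K) (br : V -> V -> V)
  (J : V -> Prop) : Prop :=
  subspace J /\ (forall x y, J y -> J (br x y)).

(* ---------- The Kac--Moody algebra g(A) ----------
   Data: a complex Lie algebra (V, br), the Cartan subalgebra given as a
   finite-dimensional space hT with an injective linear embedding iota,
   simple roots alpha i in h^*, simple coroots coroot i in h, and Chevalley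
   generators e i, f i.  [is_KM_algebra] says that (h, alpha, coroot) is a
   realization of A and that V is g(A): it is generated by e, f, h subject to
   the defining relations of g~(A), and it has no nonzero ideal meeting h
   trivially (so V = g~(A)/r, Kac, Section 1.3). *)
Definition is_KM_algebra (R : realType) (n : nat) (A : 'M[int]_n)
  (V : lmodType R[i]) (br : V -> V -> V)
  (hT : vectType R[i]) (iota : hT -> V)
  (alpha : 'I_n -> hT -> R[i]) (coroot : 'I_n -> hT) (e f : 'I_n -> V) : Prop :=
  is_lie_bracket br /\
  [/\
    (forall (a : R[i]) t u, iota (a *: t + u) = a *: iota t + iota u) /\
    (forall t u, iota t = iota u -> t = u),
    [/\ \dim (fullv : {vspace hT}) = (2 * n - \rank (map_mx intr A : 'M[R[i]]_n))%N,
        (forall i (a : R[i]) t u, alpha i (a *: t + u) = a * alpha i t + alpha i u),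
        (forall c : 'I_n -> R[i], (forall t, \sum_i c i * alpha i t = 0) -> forall i, c i = 0),
        (forall c : 'I_n -> R[i], \sum_i c i *: coroot i = 0 -> forall i, c i = 0)
      & (forall i j, alpha j (coroot i) = (A i j)%:~R)],
    [/\ (forall i j, br (e i) (f j) = if i == j then iota (coroot i) else 0),
        (forall t u, br (iota t) (iota u) = 0),
        (forall t i, br (iota t) (e i) = alpha i t *: e i)
      & (forall t i, br (iota t) (f i) = - alpha i t *: f i)],
    (forall S : V -> Prop, subspace S -> (forall x y, S x -> S y -> S (br x y)) ->
       (forall t, S (iota t)) -> (forall i, S (e i)) -> (forall i, S (f i)) ->
       forall x, S x)
  &
    (forall J : V -> Prop, lie_ideal br J ->
       (forall t, J (iota t) -> iota t = 0) -> forall x, J x -> x = 0)].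

Definition root_space (R : realType) (V : lmodType R[i]) (br : V -> V -> V)
  (hT : vectType R[i]) (iota : hT -> V) (lambda : hT -> R[i]) (x : V) : Prop :=
  forall t, br (iota t) x = lambda t *: x.

Definition is_root (R : realType) (V : lmodType R[i]) (br : V -> V -> V)
  (hT : vectType R[i]) (iota : hT -> V) (lambda : hT -> R[i]) : Prop :=
  (exists t, lambda t != 0) /\ (exists x, x != 0 /\ root_space br iota lambda x).

Definition standard_form_h (R : realType) (n : nat) (hT : vectType R[i])
  (alpha : 'I_n -> hT -> R[i]) (coroot : 'I_n -> hT) (form : hT -> hT -> R[i]) : Prop :=
  [/\ (forall (a : R[i]) t u w, form (a *: t + u) w = a * form t w + form u w),
      (forall t u, form t u = form u t),
      (forall t, (forall u, form t u = 0) -> t = 0)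
    & exists eps : 'I_n -> rat, (forall i, 0 < eps i) /\
        (forall i t, form (coroot i) t = alpha i t * ratr (eps i))].

(* the induced form on h^*: (lambda | mu) = c, via nu : h -> h^* *)
Definition induced_form (R : realType) (hT : vectType R[i]) (form : hT -> hT -> R[i])
  (lambda mu : hT -> R[i]) (c : R[i]) : Prop :=
  exists hl hm : hT, (forall t, form hl t = lambda t) /\
    (forall t, form hm t = mu t) /\ form hl hm = c.

Definition line (R : realType) (V : lmodType R[i]) (x : V) : V -> Prop :=
  fun v => exists c : R[i], v = c *: x.

(* Main.v *)
(* The algebra carries an invariant form B and an antilinear anti-involution
   x |-> x' exchanging e_i and f_i, so that (x, y) |-> B(x, y') is Hermitian and
   contravariant. The key point is that it is positive definite on every root
   space (Kac, Theorem 11.7). By induction on the height of a positive root k: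
   the cobracket sum u_i (x) v_i of x in the root space satisfies
   c(k) x = sum [u_i, v_i] with c(k) = 2(rho|k) - (k|k), whence
   c(k) B(x', x) = sum_ij B(u_i', u_j) B(v_i', v_j), which is nonnegative by the
   Schur product theorem; and c(k) > 0 for k not simple, by descending along
   simple reflections. Definiteness follows by nondegeneracy of B.
   If x and y are root vectors for a and b with [x, y] = 0, then expanding
   B([x', [x, y]], y') = 0 gives (a|b) B(x, x') B(y, y') = B(z, z') with
   z = [x', y]. For a <> b the right-hand side is nonnegative and the left-hand
   side negative; for a = b the identity is the equality case of
   Cauchy-Schwarz, so x and y are proportional. *)
Require Import Defs.
From HB Require Import structures.
From mathcomp Require Import all_boot all_order all_algebra.
From mathcomp Require Import boolp reals complex zify ring sesquilinear spectral.
Import Order.TTheory GRing.Theory Num.Theory.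
Local Open Scope ring_scope.
Set Implicit Arguments.
Unset Strict Implicit.
Unset Printing Implicit Defensive.

Local Open Scope sesquilinear_scope.

(** Neither the invariant form nor the anti-involution belongs to the data; both are built from the
    fact that the generators generate and that no nonzero ideal meets the Cartan subalgebra
    trivially. The form is forced by a grading element t0 with alpha_i(t0) = 1: invariance requires
    deg(x) B(x, y) = (t0|[x, y]), which is taken as the definition in nonzero degree. The usual
    Casimir element sums over dual bases of root spaces. Here the cobracket of x is instead a finite
    list of pure tensors, grown along the brackets with e_i that produce x and characterised by
    duality with B, so no bases are chosen. The constant c(k) solves the resulting recursion
    c(alpha_i + k) = c(k) - 2(alpha_i|k) with c(alpha_i) = 0. No Weyl group is constructed either:
    the descent uses the local nilpotency of ad e_i and sl2-strings, one simple reflection at a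
    time. *)

Lemma schur_sum_ge0 (C : numClosedFieldType) (m : nat) (G H : 'M[C]_m) :
  (forall c : 'I_m -> C, 0 <= \sum_i \sum_j (c i)^* * c j * G i j) ->
  (forall c : 'I_m -> C, 0 <= \sum_i \sum_j (c i)^* * c j * H i j) ->
  (forall i j, H j i = (H i j)^*) ->
  0 <= \sum_i \sum_j G i j * H i j.
Proof.
move=> psdG psdH hermH.
have /hermitian_normalmx/orthomx_spectralP hH : H \is hermsymmx.
  by apply/is_hermitianmxP; rewrite expr0 scale1r; apply/matrixP => i j; rewrite !mxE hermH.
have Pu := spectral_unitarymx H; rewrite invmx_unitary // in hH.
set P := spectralmx H in hH Pu; set d := spectral_diag H in hH.
have HE i j : H i j = \sum_k (P k i)^* * d 0 k * P k j.
  rewrite hH mxE; apply: eq_bigr => k _; congr (_ * _).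
  by rewrite mul_mx_diag !mxE.
have dE k : d 0 k = \sum_i \sum_j (P k i) * (P k j)^* * H i j.
  have /unitarymxP PP := Pu.
  have : P *m H *m P ^t* = diag_mx d.
    by rewrite hH !mulmxA PP mul1mx -mulmxA PP mulmx1.
  move/matrixP/(_ k k); rewrite !mxE eqxx mulr1n => <-.
  rewrite exchange_big; apply: eq_bigr => j _ /=; rewrite !mxE mulr_suml.
  by apply: eq_bigr => i _; rewrite mulrAC.
(* Each eigenvalue is the value of the form of [H] at a conjugated row of [P]. *)
have d_ge0 k : 0 <= d 0 k.
  rewrite dE; have := psdH (fun i => (P k i)^*).
  by under eq_bigr => i _ do under eq_bigr => j _ do rewrite conjCK.
(* Inserting the spectral decomposition of [H] leaves a combination, with the eigenvalues as
   weights, of values of the form of [G] at the rows of [P]. *)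
suff -> : \sum_i \sum_j G i j * H i j
    = \sum_k d 0 k * \sum_i \sum_j (P k i)^* * P k j * G i j.
  by apply: sumr_ge0 => k _; rewrite mulr_ge0.
under [RHS]eq_bigr => k _ do rewrite mulr_sumr.
rewrite [RHS]exchange_big; apply: eq_bigr => i _ /=.
under [RHS]eq_bigr => k _ do rewrite mulr_sumr.
rewrite [RHS]exchange_big; apply: eq_bigr => j _ /=.
rewrite HE mulr_sumr; apply: eq_bigr => k _.
by rewrite [in LHS]mulrC -!mulrA mulrCA !mulrA.
Qed.
Local Close Scope sesquilinear_scope.

Lemma big_uniq1 (U : zmodType) (I : eqType) (s : seq I) (F : I -> U) i :
  uniq s -> i \in s -> \sum_(j <- s | j == i) F j = F i.
Proof.
move=> us si; rewrite big_mkcond (bigD1_seq i) //= eqxx big1 ?addr0 //.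
by move=> j /negPf ->.
Qed.

(** * Lie brackets *)

Section LieBracket.
Variables (K : fieldType) (V : lmodType K) (br : V -> V -> V).
Hypothesis lie : is_lie_bracket br.

Lemma br_linl a x y z : br (a *: x + y) z = a *: br x z + br y z.
Proof. by case: lie. Qed.

Lemma br_linr a x y z : br z (a *: x + y) = a *: br z x + br z y.
Proof. by case: lie => _ []. Qed.

Lemma brxx x : br x x = 0.
Proof. by case: lie => _ [_ []]. Qed.

Lemma brDl x y z : br (x + y) z = br x z + br y z.
Proof. by rewrite -[x]scale1r br_linl !scale1r. Qed.

Lemma brDr x y z : br z (x + y) = br z x + br z y.
Proof. by rewrite -[x]scale1r br_linr !scale1r. Qed.

Lemma br0l z : br 0 z = 0.
Proof. by apply: (addIr (br 0 z)); rewrite -brDl !add0r. Qed.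

Lemma br0r z : br z 0 = 0.
Proof. by apply: (addIr (br z 0)); rewrite -brDr !add0r. Qed.

Lemma brZl a x z : br (a *: x) z = a *: br x z.
Proof. by rewrite -[a *: x]addr0 br_linl br0l addr0. Qed.

Lemma brZr a x z : br z (a *: x) = a *: br z x.
Proof. by rewrite -[a *: x]addr0 br_linr br0r addr0. Qed.

Lemma brNl x z : br (- x) z = - br x z.
Proof. by rewrite -scaleN1r brZl scaleN1r. Qed.

Lemma brNr x z : br z (- x) = - br z x.
Proof. by rewrite -scaleN1r brZr scaleN1r. Qed.

Lemma br_sumr (I : Type) (r : seq I) (Q : pred I) (F : I -> V) z :
  br z (\sum_(i <- r | Q i) F i) = \sum_(i <- r | Q i) br z (F i).
Proof. by apply: (big_morph (br z)) => [x y|]; rewrite ?brDr ?br0r. Qed.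

Lemma brC x y : br x y = - br y x.
Proof.
apply/eqP; rewrite -addr_eq0; apply/eqP.
by have := brxx (x + y); rewrite brDl !brDr !brxx add0r addr0.
Qed.

Lemma jacobi x y z : br x (br y z) = br (br x y) z + br y (br x z).
Proof.
case: lie => _ [_ [_ /(_ x y z)]].
rewrite [br z x]brC [br z _]brC brNr => /eqP.
by rewrite -addrA -opprD subr_eq0 addrC => /eqP.
Qed.

Lemma jacobil x y z : br (br x y) z = br x (br y z) - br y (br x z).
Proof. by rewrite (jacobi x y z) addrK. Qed.

Lemma jacobi_sum x y z : br (br x y) z + br (br y z) x + br (br z x) y = 0.
Proof.
rewrite [br (br x y) z]brC [br (br y z) x]brC [br (br z x) y]brC -!opprD.
by case: lie => _ [_ [_ /(_ x y z) h]]; rewrite -addrA addrC h oppr0.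
Qed.

End LieBracket.

(** * The axioms of the algebra, unpacked over an abstract closed field with conjugation *)

Section KacMoody.
Variables (K : numClosedFieldType) (n : nat) (A : 'M[int]_n).
Variables (V : lmodType K) (br : V -> V -> V) (hT : vectType K) (iota : hT -> V).
Variables (alpha : 'I_n -> hT -> K) (coroot : 'I_n -> hT) (e f : 'I_n -> V).
Variables (form : hT -> hT -> K) (eps : 'I_n -> K).

Hypothesis A_GCM : is_GCM A.
Hypothesis lie : is_lie_bracket br.
Hypothesis iota_lin : forall a t u, iota (a *: t + u) = a *: iota t + iota u.
Hypothesis iota_inj : injective iota.
Hypothesis alpha_lin : forall i a t u, alpha i (a *: t + u) = a * alpha i t + alpha i u.
Hypothesis alpha_free :
  forall c : 'I_n -> K, (forall t, \sum_i c i * alpha i t = 0) -> forall i, c i = 0.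
Hypothesis coroot_free :
  forall c : 'I_n -> K, \sum_i c i *: coroot i = 0 -> forall i, c i = 0.
Hypothesis alpha_coroot : forall i j, alpha j (coroot i) = (A i j)%:~R.
Hypothesis br_ef : forall i j, br (e i) (f j) = if i == j then iota (coroot i) else 0.
Hypothesis br_hh : forall t u, br (iota t) (iota u) = 0.
Hypothesis br_he : forall t i, br (iota t) (e i) = alpha i t *: e i.
Hypothesis br_hf : forall t i, br (iota t) (f i) = - alpha i t *: f i.
Hypothesis generated : forall S : V -> Prop, subspace S ->
  (forall x y, S x -> S y -> S (br x y)) ->
  (forall t, S (iota t)) -> (forall i, S (e i)) -> (forall i, S (f i)) ->
  forall x, S x.
Hypothesis no_ideal : forall J : V -> Prop, lie_ideal br J ->
  (forall t, J (iota t) -> iota t = 0) -> forall x, J x -> x = 0.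
Hypothesis form_lin : forall a t u w, form (a *: t + u) w = a * form t w + form u w.
Hypothesis formC : forall t u, form t u = form u t.
Hypothesis form_nondeg : forall t, (forall u, form t u = 0) -> t = 0.
Hypothesis eps_gt0 : forall i, 0 < eps i.
Hypothesis form_coroot : forall i t, form (coroot i) t = alpha i t * eps i.

Local Notation weight := 'rV[int]_n.

Let brDl := brDl lie.
Let brDr := brDr lie.
Let br0l := br0l lie.
Let br0r := br0r lie.
Let brZl := brZl lie.
Let brZr := brZr lie.
Let brNl := brNl lie.
Let brNr := brNr lie.
Let br_sumr := br_sumr lie.
Let brC := brC lie.
Let brxx := brxx lie.
Let jacobi := jacobi lie.
Let jacobil := jacobil lie.
Let jacobi_sum := jacobi_sum lie.

Lemma iotaD t u : iota (t + u) = iota t + iota u.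
Proof. by rewrite -[t]scale1r iota_lin !scale1r. Qed.

Lemma iota0 : iota 0 = 0.
Proof. by apply: (addIr (iota 0)); rewrite -iotaD !add0r. Qed.

Lemma iotaZ a t : iota (a *: t) = a *: iota t.
Proof. by rewrite -[a *: t]addr0 iota_lin iota0 addr0. Qed.

Lemma iotaN t : iota (- t) = - iota t.
Proof. by rewrite -(scaleN1r t) iotaZ scaleN1r. Qed.

Lemma alphaD i t u : alpha i (t + u) = alpha i t + alpha i u.
Proof. by rewrite -[t]scale1r alpha_lin scale1r mul1r. Qed.

Lemma alpha0 i : alpha i 0 = 0.
Proof. by apply: (addIr (alpha i 0)); rewrite -alphaD !add0r. Qed.

Lemma alphaZ i a t : alpha i (a *: t) = a * alpha i t.
Proof. by rewrite -[a *: t]addr0 alpha_lin alpha0 addr0. Qed.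

Lemma alpha_sum (I : Type) (r : seq I) (Q : pred I) (F : I -> hT) i :
  alpha i (\sum_(j <- r | Q j) F j) = \sum_(j <- r | Q j) alpha i (F j).
Proof. by apply: (big_morph (alpha i) (alphaD i) (alpha0 i)). Qed.

Lemma formDl t u w : form (t + u) w = form t w + form u w.
Proof. by rewrite -[t]scale1r form_lin scale1r mul1r. Qed.

Lemma form0l w : form 0 w = 0.
Proof. by apply: (addIr (form 0 w)); rewrite -formDl !add0r. Qed.

Lemma formZl a t w : form (a *: t) w = a * form t w.
Proof. by rewrite -[a *: t]addr0 form_lin form0l addr0. Qed.

Lemma formDr t u w : form w (t + u) = form w t + form w u.
Proof. by rewrite !(formC w) formDl. Qed.

Lemma formZr a t w : form w (a *: t) = a * form w t.
Proof. by rewrite !(formC w) formZl. Qed.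

Lemma form0r w : form w 0 = 0.
Proof. by rewrite formC form0l. Qed.

(** * Weights *)

Definition simple_wt (i : 'I_n) : weight := delta_mx 0 i.
(** Weights are integer coordinate vectors on the simple roots, which makes heights and signs
    directly computable. By [wt_inj] the functional determines the vector, and [joint_eigen_wt]
    brings arbitrary roots to this form. *)
Definition wt (k : weight) (t : hT) : K := \sum_i (k 0 i)%:~R * alpha i t.
Definition ht (k : weight) : int := \sum_i k 0 i.
Definition W k (x : V) := forall t, br (iota t) x = wt k t *: x.

Lemma wtD k l t : wt (k + l) t = wt k t + wt l t.
Proof.
rewrite /wt -big_split; apply: eq_bigr => i _.
by rewrite mxE intrD mulrDl.
Qed.

Lemma wtN k t : wt (- k) t = - wt k t.
Proof.
rewrite /wt -sumrN; apply: eq_bigr => i _.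
by rewrite mxE mulrNz mulNr.
Qed.

Lemma wt0 t : wt 0 t = 0.
Proof. by rewrite /wt big1 // => i _; rewrite mxE mul0r. Qed.

Lemma wt_simple i t : wt (simple_wt i) t = alpha i t.
Proof.
rewrite /wt (bigD1 i) //= big1 => [|j ji]; first by rewrite mxE !eqxx mul1r addr0.
by rewrite mxE (negPf ji) andbF mul0r.
Qed.

Lemma wt_lin k a t u : wt k (a *: t + u) = a * wt k t + wt k u.
Proof.
rewrite /wt mulr_sumr -big_split; apply: eq_bigr => i _ /=.
by rewrite alpha_lin mulrDr mulrCA.
Qed.

Lemma wt_inj k l : (forall t, wt k t = wt l t) -> k = l.
Proof.
move=> kl; apply/rowP => i; apply/eqP; rewrite -subr_eq0 -(intr_eq0 K).
have := @alpha_free (fun i => (k 0 i - l 0 i)%:~R).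
move=> -> // t.
have := kl t; move/eqP; rewrite -subr_eq0 -wtN -wtD => /eqP {2}<-.
by apply: eq_bigr => j _; rewrite !mxE.
Qed.

Lemma wt_sep k l : k != l -> exists t, wt k t != wt l t.
Proof.
move=> kl; apply/not_existsP => h; move/eqP: kl; apply; apply: wt_inj => t.
by apply/eqP/negPn/negP/(h t).
Qed.

Lemma htD k l : ht (k + l) = ht k + ht l.
Proof. by rewrite /ht -big_split; apply: eq_bigr => i _; rewrite mxE. Qed.

Lemma htN k : ht (- k) = - ht k.
Proof. by rewrite /ht -sumrN; apply: eq_bigr => i _; rewrite mxE. Qed.

Lemma ht0 : ht 0 = 0.
Proof. by rewrite /ht big1 // => i _; rewrite mxE. Qed.

Lemma ht_simple i : ht (simple_wt i) = 1.
Proof.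
rewrite /ht (bigD1 i) //= big1 => [|j ji]; first by rewrite mxE !eqxx addr0.
by rewrite mxE (negPf ji) andbF.
Qed.

Lemma W_lin k a x y : W k x -> W k y -> W k (a *: x + y).
Proof. by move=> hx hy t; rewrite brDr brZr hx hy scalerDr !scalerA mulrC. Qed.

Lemma W0 k : W k 0.
Proof. by move=> t; rewrite br0r scaler0. Qed.

Lemma WD k x y : W k x -> W k y -> W k (x + y).
Proof. by move=> hx hy; rewrite -[x]scale1r; apply: W_lin. Qed.

Lemma WZ k a x : W k x -> W k (a *: x).
Proof. by move=> h; rewrite -[_ *: _]addr0; apply: W_lin => //; apply: W0. Qed.

Lemma WN k x : W k x -> W k (- x).
Proof. by rewrite -scaleN1r; apply: WZ. Qed.

Lemma W_sum (I : Type) (r : seq I) (Q : pred I) (F : I -> V) k :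
  (forall i, Q i -> W k (F i)) -> W k (\sum_(i <- r | Q i) F i).
Proof. by move=> h; apply: big_ind => //; [apply: W0 | apply: WD]. Qed.

Lemma W_br k l x y : W k x -> W l y -> W (k + l) (br x y).
Proof. by move=> hx hy t; rewrite jacobi hx hy brZl brZr wtD scalerDl. Qed.

Lemma W_e i : W (simple_wt i) (e i).
Proof. by move=> t; rewrite br_he wt_simple. Qed.

Lemma W_f i : W (- simple_wt i) (f i).
Proof. by move=> t; rewrite br_hf wtN wt_simple. Qed.

Lemma W_iota u : W 0 (iota u).
Proof. by move=> t; rewrite br_hh wt0 scale0r. Qed.

Lemma W_uniq k l x : W k x -> W l x -> x != 0 -> k = l.
Proof.
move=> hk hl x0; apply: wt_inj => t; apply/eqP; rewrite -subr_eq0.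
have : (wt k t - wt l t) *: x = 0 by rewrite scalerBl -hk -hl subrr.
by move/eqP; rewrite scaler_eq0 (negPf x0) orbF.
Qed.

(** Subtracting the scalar [wt k0 t] from the action of [t] removes the term at [k0]; a [t]
    separating [k] from [k0] keeps the term at [k] up to a nonzero factor. *)
Lemma W_indep (s : seq weight) (X : weight -> V) :
  uniq s -> (forall k, k \in s -> W k (X k)) ->
  \sum_(k <- s) X k = 0 -> forall k, k \in s -> X k = 0.
Proof.
elim: s X => [|k0 s IH] X //= /andP[k0s us] hW; rewrite big_cons => hs.
have tail k : k \in s -> X k = 0.
  move=> ks; have nk : k != k0 by apply: contraNneq k0s => <-.
  have [t ht] := wt_sep nk.
  have hW' l : l \in s -> W l ((wt l t - wt k0 t) *: X l).
    by move=> ls; apply/WZ/hW; rewrite inE ls orbT.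
  have hs' : \sum_(l <- s) (wt l t - wt k0 t) *: X l = 0.
    transitivity (br (iota t) (\sum_(l <- s) X l) - wt k0 t *: \sum_(l <- s) X l).
      rewrite br_sumr scaler_sumr -sumrB; apply: eq_big_seq => l ls.
      by rewrite scalerBl hW // inE ls orbT.
    have -> : \sum_(l <- s) X l = - X k0.
      by apply/eqP; rewrite -addr_eq0 addrC hs.
    by rewrite brNr hW ?mem_head // scalerN subrr.
  move/eqP: (IH _ us hW' hs' _ ks).
  by rewrite scaler_eq0 subr_eq0 (negPf ht) => /eqP.
move=> k; rewrite inE => /orP[/eqP->|/tail//].
by move: hs; rewrite big_seq big1 ?addr0 // => l /tail.
Qed.

(** Several entries of [L] may share a weight, so they are grouped first; subtracting the total at
    [k] then yields a vanishing sum over distinct weights. *)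
Lemma W_component (L : seq (weight * V)) k :
  (forall p, p \in L -> W p.1 p.2) -> W k (\sum_(p <- L) p.2) ->
  \sum_(p <- L) p.2 = \sum_(p <- L | p.1 == k) p.2.
Proof.
move=> hL hk; set v := \sum_(p <- L) p.2.
pose s := undup (k :: map fst L).
pose X l := \sum_(p <- L | p.1 == l) p.2 - (if l == k then v else 0).
have us : uniq s by apply: undup_uniq.
have ks : k \in s by rewrite mem_undup mem_head.
have hX l : l \in s -> W l (X l).
  move=> _; apply: WD; first by rewrite big_seq_cond; apply: W_sum => p /andP[/hL + /eqP <-].
  by case: eqP => [->|_]; [apply: WN|rewrite oppr0; apply: W0].
have sX : \sum_(l <- s) X l = 0.
  rewrite sumrB -big_mkcond big_uniq1 //; apply/eqP; rewrite subr_eq0; apply/eqP.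
  rewrite (exchange_big_dep xpredT) //= [RHS]big_seq big_seq; apply: eq_bigr => p pL.
  under eq_bigl => l do rewrite eq_sym.
  by rewrite big_uniq1 // mem_undup inE; apply/orP; right; apply: map_f.
have := W_indep us hX sX ks.
by rewrite /X eqxx => /eqP; rewrite subr_eq0 => /eqP.
Qed.

(** * The antilinear anti-involution and the triangular decomposition *)

(** The additive span of [Q] inside the product of [V] with itself: partial antilinear maps are
    handled through their graphs. *)
Inductive sums (Q : V -> V -> Prop) : V -> V -> Prop :=
| sums0 : sums Q 0 0
| sums_cons x x' y y' : Q x x' -> sums Q y y' -> sums Q (x + y) (x' + y').

Definition semilin_closed (Q : V -> V -> Prop) :=
  forall c x x' y y', Q x x' -> Q y y' -> Q (c *: x + y) (c^* *: x' + y').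

Lemma sums1 (Q : V -> V -> Prop) x x' : Q x x' -> sums Q x x'.
Proof. by move=> h; rewrite -[x]addr0 -[x']addr0; apply: sums_cons h (sums0 _). Qed.

Lemma sumsD Q x x' y y' : sums Q x x' -> sums Q y y' -> sums Q (x + y) (x' + y').
Proof.
move=> h hy; elim: h => [|u u' v v' hu _ IH]; first by rewrite !add0r.
by rewrite -!addrA; apply: sums_cons.
Qed.

Lemma sumsZ Q c x x' :
  (forall u u', Q u u' -> Q (c *: u) (c^* *: u')) ->
  sums Q x x' -> sums Q (c *: x) (c^* *: x').
Proof.
move=> hQ; elim => [|u u' v v' hu _ IH]; first by rewrite !scaler0; apply: sums0.
by rewrite !scalerDr; apply: sums_cons => //; apply: hQ.
Qed.

Lemma sums_map (Q Q' : V -> V -> Prop) (F F' : V -> V) x x' :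
  (forall u v, F (u + v) = F u + F v) -> (forall u v, F' (u + v) = F' u + F' v) ->
  F 0 = 0 -> F' 0 = 0 ->
  (forall u u', Q u u' -> sums Q' (F u) (F' u')) ->
  sums Q x x' -> sums Q' (F x) (F' x').
Proof.
move=> FD FD' F0 F0' h; elim => [|u u' v v' /h hu _ IH].
  by rewrite F0 F0'; apply: sums0.
by rewrite FD FD'; apply: sumsD.
Qed.

(* [pospair k x x'] says that [x] lies in the weight space of [k] inside the
   subalgebra generated by the [e i], and that [x'] is its image under the
   antilinear anti-involution exchanging [e i] and [f i]. Carrying this
   anti-involution as a relation, first on n_+ and in [adjpair] on the whole
   derived algebra, avoids having to prove beforehand that it exists. *)
Inductive pospair : weight -> V -> V -> Prop :=
| pospair_gen i : pospair (simple_wt i) (e i) (f i)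
| pospair_lin k c x x' y y' : pospair k x x' -> pospair k y y' ->
    pospair k (c *: x + y) (c^* *: x' + y')
| pospair_br k i x x' : pospair k x x' ->
    pospair (simple_wt i + k) (br (e i) x) (br x' (f i)).

(** The anti-involution fixes every coroot, hence conjugates coefficients on their span. The rest of
    the Cartan subalgebra carries no preferred real structure and is left out. *)
Definition hpair (x x' : V) := exists c : 'I_n -> K,
  x = iota (\sum_i c i *: coroot i) /\ x' = iota (\sum_i (c i)^* *: coroot i).

Definition wtpair k (x x' : V) :=
  pospair k x x' \/ pospair (- k) x' x \/ k = 0 /\ hpair x x'.

Definition adjpair := sums (fun x x' => exists k, wtpair k x x').

Definition pos (k : weight) := (forall i, 0 <= k 0 i) /\ 0 < ht k.

Lemma pospair0 k x x' : pospair k x x' -> pospair k 0 0.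
Proof.
move=> h; have := pospair_lin (-1) h h.
by rewrite rmorphN rmorph1 !scaleN1r !addNr.
Qed.

Lemma pospairZ k c x x' : pospair k x x' -> pospair k (c *: x) (c^* *: x').
Proof.
move=> h; rewrite -[c *: x]addr0 -[_ *: x']addr0.
by apply: pospair_lin => //; apply: pospair0 h.
Qed.

Lemma pospair_pos k x x' : pospair k x x' -> pos k.
Proof.
elim => {k x x'} [i||k i x x' _ [h1 h2]] //.
  by split=> [j|]; rewrite ?ht_simple // mxE eqxx /=; case: (_ == _).
split=> [j|]; last by rewrite htD ht_simple addrC ltr_wpDr.
by rewrite !mxE eqxx addr_ge0 //=; case: (_ == _).
Qed.

Lemma pos_opp k : pos k -> ~ pos (- k).
Proof. by move=> [_ h] [_]; rewrite htN oppr_gt0 => h'; have := lt_trans h h'; rewrite ltxx. Qed.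

Lemma pos0 : ~ pos 0.
Proof. by case=> _; rewrite ht0 ltxx. Qed.

Lemma pospair_W k x x' : pospair k x x' -> W k x /\ W (- k) x'.
Proof.
elim => {k x x'} [i|k c x x' y y' _ [h1 h2] _ [h3 h4]|k i x x' _ [h1 h2]].
- by split; [apply: W_e|apply: W_f].
- by split; apply: W_lin.
- by split; [apply: W_br (W_e i) _|rewrite opprD addrC; apply: W_br (W_f i)].
Qed.

Lemma hpair_lin : semilin_closed hpair.
Proof.
move=> a x x' y y' [c [-> ->]] [d [-> ->]]; exists (fun i => a * c i + d i).
split; rewrite -iota_lin; congr iota; rewrite scaler_sumr -big_split;
  apply: eq_bigr => i _ /=; first by rewrite scalerDl scalerA.
by rewrite rmorphD rmorphM scalerDl scalerA.
Qed.

Lemma hpair0 : hpair 0 0.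
Proof.
by exists (fun _ => 0); split; rewrite big1 ?iota0 // => i _; rewrite ?rmorph0 scale0r.
Qed.

Lemma hpair_coroot i : hpair (iota (coroot i)) (iota (coroot i)).
Proof.
exists (fun j => (j == i)%:R); split; congr iota; rewrite (bigD1 i) //= eqxx.
  by rewrite scale1r big1 ?addr0 // => j /negPf ->; rewrite scale0r.
by rewrite rmorph1 scale1r big1 ?addr0 // => j /negPf ->; rewrite rmorph0 scale0r.
Qed.

Lemma hpair_sym x x' : hpair x x' -> hpair x' x.
Proof.
move=> [c [-> ->]]; exists (fun i => (c i)^*); split=> //.
by congr iota; apply: eq_bigr => i _; rewrite conjCK.
Qed.

Lemma conj_alpha c i : (alpha i (\sum_j c j *: coroot j))^*
  = alpha i (\sum_j (c j)^* *: coroot j).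
Proof.
rewrite !alpha_sum rmorph_sum; apply: eq_bigr => j _.
by rewrite !alphaZ rmorphM alpha_coroot rmorph_int.
Qed.

Lemma conj_wt_coroot k i : (wt k (coroot i))^* = wt k (coroot i).
Proof.
rewrite /wt rmorph_sum; apply: eq_bigr => j _.
by rewrite rmorphM alpha_coroot !rmorph_int.
Qed.

Lemma wtpair_sym k x x' : wtpair k x x' -> wtpair (- k) x' x.
Proof.
case=> [h|[h|[-> h]]]; first by right; left; rewrite opprK.
  by left.
by right; right; rewrite oppr0; split=> //; apply: hpair_sym.
Qed.

Lemma wtpair_W k x x' : wtpair k x x' -> W k x /\ W (- k) x'.
Proof.
case=> [/pospair_W //|[/pospair_W[h1 h2]|[-> [c [-> ->]]]]]; first by rewrite opprK in h2.
by rewrite oppr0; split; apply: W_iota.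
Qed.

Lemma wtpair_lin k : semilin_closed (wtpair k).
Proof.
move=> c x x' y y' [h|[h|[k0 h]]] [h'|[h'|[k0' h']]].
- by left; apply: pospair_lin.
- by case: (pos_opp (pospair_pos h) (pospair_pos h')).
- by move: (pospair_pos h); rewrite k0' => /pos0.
- by case: (pos_opp (pospair_pos h') (pospair_pos h)).
- by right; left; have := pospair_lin c^* h h'; rewrite conjCK.
- by move: (pospair_pos h); rewrite k0' oppr0 => /pos0.
- by move: (pospair_pos h'); rewrite k0 => /pos0.
- by move: (pospair_pos h'); rewrite k0 oppr0 => /pos0.
- by right; right; split=> //; apply: hpair_lin.
Qed.

Lemma wtpairZ k c x x' : wtpair k x x' -> wtpair k (c *: x) (c^* *: x').
Proof.
move=> h; have h0 := wtpair_lin (-1) h h.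
have := wtpair_lin c h h0.
by rewrite rmorphN rmorph1 !scaleN1r !addNr !addr0.
Qed.

Lemma adjpair_wt k x x' : wtpair k x x' -> adjpair x x'.
Proof. by move=> h; apply: sums1; exists k. Qed.

Lemma adjpairZ c x x' : adjpair x x' -> adjpair (c *: x) (c^* *: x').
Proof. by apply: sumsZ => u u' [k h]; exists k; apply: wtpairZ. Qed.

Lemma adjpairN x x' : adjpair x x' -> adjpair (- x) (- x').
Proof. by move/(adjpairZ (-1)); rewrite rmorphN rmorph1 !scaleN1r. Qed.

Lemma adjpair_lin : semilin_closed adjpair.
Proof. by move=> c x x' y y' hx hy; apply: sumsD => //; apply: adjpairZ. Qed.

Lemma adjpairB x x' y y' : adjpair x x' -> adjpair y y' -> adjpair (x - y) (x' - y').
Proof. by move=> hx hy; apply: sumsD => //; apply: adjpairN. Qed.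

Lemma adjpair_sym x x' : adjpair x x' -> adjpair x' x.
Proof.
elim => [|u u' v v' [k h] _ IH]; first exact: sums0.
by apply: sums_cons => //; exists (- k); apply: wtpair_sym.
Qed.

(** The Cartan part together with n_+. Bracketing with [f i] sends n_+ into it, and proving this by
    induction requires stability under [e j], which is elementary here ([borelpair_e]). For
    [adjpair] the same stability is deduced from [pospair_f], so using it there would be
    circular. *)
Definition borelpair := sums (fun x x' => hpair x x' \/ exists k, pospair k x x').

Lemma borelpair_adjpair x x' : borelpair x x' -> adjpair x x'.
Proof.
apply: (@sums_map _ _ id id) => // u u' [h|[k h]]; apply: sums1.
  by exists 0; right; right.
by exists k; left.
Qed.

Lemma br_e_hpair i x x' : hpair x x' -> pospair (simple_wt i) (br (e i) x) (br x' (f i)).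
Proof.
move=> [c [-> ->]]; rewrite brC br_he br_hf -conj_alpha.
by rewrite -scaleNr -rmorphN; apply: pospairZ; apply: pospair_gen.
Qed.

Lemma borelpair_e i x x' : borelpair x x' -> borelpair (br (e i) x) (br x' (f i)).
Proof.
apply: (@sums_map _ _ (br (e i)) (br^~ (f i))) => [u v|u v|||u u' [h|[k h]]]; rewrite ?brDl ?brDr ?br0l ?br0r //;
  apply: sums1; right.
  by exists (simple_wt i); apply: br_e_hpair.
by exists (simple_wt i + k); apply: pospair_br.
Qed.

Lemma pospair_f k i x x' :
  pospair k x x' -> borelpair (br x (f i)) (br (e i) x').
Proof.
elim => {k x x'} [j|k c x x' y y' _ IH1 _ IH2|k j x x' hx IH].
- rewrite !br_ef eq_sym; case: eqP => [->|_]; last exact: sums0.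
  by apply: sums1; left; apply: hpair_coroot.
- rewrite brDl brDr brZl brZr; apply: sumsD => //; apply: sumsZ IH1.
  move=> u u' [h|[l h]]; last by right; exists l; apply: pospairZ.
  by left; have := hpair_lin c h hpair0; rewrite !addr0.
- have -> : br (br (e j) x) (f i)
      = br (e j) (br x (f i)) + (if i == j then wt k (coroot i) else 0) *: x.
    rewrite jacobil br_ef eq_sym; case: eqP => [->|_]; last by rewrite br0r scale0r subr0 addr0.
    by rewrite [br x (iota _)]brC opprK; case: (pospair_W hx) => ->.
  have -> : br (e i) (br x' (f j))
      = br (br (e i) x') (f j) + (if i == j then wt k (coroot i) else 0)^* *: x'.
    rewrite jacobi br_ef; case: eqP => [_|_]; last by rewrite br0r rmorph0 scale0r.
    rewrite conj_wt_coroot [br x' _]brC; case: (pospair_W hx) => _ ->.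
    by rewrite wtN scaleNr opprK.
  apply: sumsD; first exact: borelpair_e.
  by apply: sums1; right; exists k; apply: pospairZ.
Qed.

Lemma adjpair_e i x x' : adjpair x x' -> adjpair (br (e i) x) (br x' (f i)).
Proof.
apply: (@sums_map _ _ (br (e i)) (br^~ (f i))) => [u v|u v|||u u' [k [h|[h|[_ h]]]]]; rewrite ?brDl ?brDr ?br0l ?br0r //.
- by apply: (@adjpair_wt (simple_wt i + k)); left; apply: pospair_br.
- by apply/adjpair_sym/borelpair_adjpair; apply: pospair_f h.
- by apply: (@adjpair_wt (simple_wt i)); left; apply: br_e_hpair.
Qed.

Lemma adjpair_f i x x' : adjpair x x' -> adjpair (br (f i) x) (br x' (e i)).
Proof.
move/adjpair_sym/(adjpair_e i)/adjpair_sym/adjpairN.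
by rewrite -brC [br (e i) _]brC opprK.
Qed.

Lemma adjpair_h x x' y y' : hpair x x' -> adjpair y y' -> adjpair (br x y) (br y' x').
Proof.
move=> [c [-> ->]]; set t := iota _; set t' := iota (\sum_i (c i)^* *: _).
apply: (@sums_map _ _ (br t) (br^~ t')) => [u v|u v|||u u' [k h]]; rewrite ?brDl ?brDr ?br0l ?br0r //.
rewrite {}/t {}/t'; apply: (@adjpair_wt k); case: (wtpair_W h) => hu hu'.
rewrite hu brC hu' wtN scaleNr opprK.
have -> : wt k (\sum_i (c i)^* *: coroot i) = (wt k (\sum_i c i *: coroot i))^*.
  by rewrite /wt [RHS]rmorph_sum; apply: eq_bigr => i _; rewrite [RHS]rmorphM rmorph_int /= conj_alpha.
exact: wtpairZ.
Qed.

(** By the Jacobi identity it suffices to let generators act. [posC] follows the construction of a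
    positive pair and treats its transpose at the same time, which settles negative weights too. *)
Lemma adjpair_br x x' y y' :
  adjpair x x' -> adjpair y y' -> adjpair (br x y) (br y' x').
Proof.
have brD z z' u u' : adjpair (br u z) (br z' u') -> forall v v',
    adjpair (br v z) (br z' v') -> adjpair (br (u + v) z) (br z' (u' + v')).
  by move=> h v v' h'; rewrite brDl brDr; apply: sumsD.
have posC k u u' : pospair k u u' -> forall z z', adjpair z z' ->
    adjpair (br u z) (br z' u') /\ adjpair (br u' z) (br z' u).
  elim => {k u u'} [i|k c u u' v v' _ IH1 _ IH2|k i u u' _ IH] z z' hz.
  - by split; [apply: adjpair_e|apply: adjpair_f].
  - have [h1 h2] := IH1 _ _ hz; have [h3 h4] := IH2 _ _ hz.
    split; apply: brD => //; rewrite brZl brZr; first exact: adjpairZ.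
    by rewrite -{2}[c]conjCK; apply: adjpairZ.
  - split.
      rewrite jacobil [br z' _]jacobi [br u' (br z' _)]brC.
      apply: adjpairB; first by apply: adjpair_e; case: (IH _ _ hz).
      by case: (IH _ _ (adjpair_e i hz)).
    rewrite jacobil [br z' _]jacobi [br (e i) (br z' _)]brC.
    apply: adjpairB; first by case: (IH _ _ (adjpair_f i hz)).
    by apply: adjpair_f; case: (IH _ _ hz).
move=> + hy; elim => [|u u' v v' [k hu] _ IH]; first by rewrite br0l br0r; apply: sums0.
apply: brD => //; case: hu => [h|[h|[_ h]]]; last exact: adjpair_h.
  by case: (posC _ _ _ h _ _ hy).
by case: (posC _ _ _ h _ _ hy).
Qed.

Lemma adjpair_list x x' : adjpair x x' -> exists L : seq (weight * (V * V)),
  [/\ forall p, p \in L -> wtpair p.1 p.2.1 p.2.2,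
      x = \sum_(p <- L) p.2.1 & x' = \sum_(p <- L) p.2.2].
Proof.
elim => [|u u' v v' [k hu] _ [L [hL -> ->]]]; first by exists [::]; rewrite !big_nil.
exists ((k, (u, u')) :: L); rewrite !big_cons; split=> // p.
by rewrite inE => /orP[/eqP ->|/hL].
Qed.

Lemma W_component_map (L : seq (weight * (V * V))) (g : weight -> weight)
    (F : V * V -> V) k : injective g ->
  (forall p, p \in L -> W (g p.1) (F p.2)) -> W (g k) (\sum_(p <- L) F p.2) ->
  \sum_(p <- L) F p.2 = \sum_(p <- L | p.1 == k) F p.2.
Proof.
move=> g_inj hL hk; have := @W_component [seq (g p.1, F p.2) | p <- L] (g k).
rewrite !big_map /=; under [in X in _ -> _ -> _ = X]eq_bigl => p do rewrite (inj_eq g_inj).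
by apply=> // _ /mapP[p pL ->]; apply: hL.
Qed.

(** The second alternative is genuine: for a nonzero weight that no chain of generators reaches,
    [wtpair k] is empty and does not even relate 0 to 0. *)
Lemma adjpair_component k x x' : W k x -> W (- k) x' -> adjpair x x' ->
  wtpair k x x' \/ x = 0 /\ x' = 0.
Proof.
move=> hx hx' /adjpair_list[L [hL ex ex']]; rewrite ex in hx; rewrite ex' in hx'.
rewrite {}ex {}ex'.
rewrite (@W_component_map L id fst k) //; last by move=> p /hL/wtpair_W[].
rewrite (@W_component_map L -%R snd k) //; try exact: oppr_inj; last by move=> p /hL/wtpair_W[].
elim: L hL {hx hx'} => [|p L IH] hL; first by rewrite !big_nil; right.
have {}IH : _ := IH (fun q hq => hL q (mem_behead (s := p :: L) hq)).
rewrite !big_cons; case: eqP => // pk; left.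
have hp := hL _ (mem_head _ _); rewrite pk in hp.
case: IH => [h|[-> ->]]; last by rewrite !addr0.
by have := wtpair_lin 1 hp h; rewrite rmorph1 !scale1r.
Qed.

Lemma adjpair_h_stable t y y' : adjpair y y' -> exists y'', adjpair (br (iota t) y) y''.
Proof.
elim => [|u u' v v' [k hu] _ [w hw]]; first by exists 0; rewrite br0r; apply: sums0.
exists ((wt k t)^* *: u' + w); rewrite brDr; case: (wtpair_W hu) => -> _.
by apply: sums_cons => //; exists k; apply: wtpairZ.
Qed.

(** Such sums form a subalgebra containing all generators: brackets with the Cartan subalgebra only
    rescale the weight pieces, and [adjpair_br] handles the others. *)
Lemma V_decomp v : exists t x x', v = iota t + x /\ adjpair x x'.
Proof.
apply: (generated (S := fun v => exists t x x', v = iota t + x /\ adjpair x x')).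
- split=> [|a _ _ [t [x [x' [-> hx]]]] [u [y [y' [-> hy]]]]].
    by exists 0, 0, 0; rewrite iota0 addr0; split=> //; apply: sums0.
  exists (a *: t + u), (a *: x + y), (a^* *: x' + y'); split; last exact: adjpair_lin.
  by rewrite iota_lin scalerDr addrACA.
- move=> _ _ [t [x [x' [-> hx]]]] [u [y [y' [-> hy]]]].
  have [y1 hy1] := adjpair_h_stable t hy; have [x1 hx1] := adjpair_h_stable u hx.
  exists 0, (br (iota t) y + (- br (iota u) x + br x y)), (y1 + (- x1 + br y' x')); split.
    by rewrite brDl !brDr br_hh -(brC x) iota0 !add0r.
  by apply: sumsD => //; apply: sumsD; [apply: adjpairN|apply: adjpair_br].
- by move=> t; exists t, 0, 0; rewrite addr0; split=> //; apply: sums0.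
- move=> i; exists 0, (e i), (f i); rewrite iota0 add0r; split=> //.
  by apply: (@adjpair_wt (simple_wt i)); left; apply: pospair_gen.
- move=> i; exists 0, (f i), (e i); rewrite iota0 add0r; split=> //; apply: adjpair_sym.
  by apply: (@adjpair_wt (simple_wt i)); left; apply: pospair_gen.
Qed.

Lemma V_component v k : W k v -> exists t (L : seq (weight * (V * V))),
  (forall p, p \in L -> wtpair p.1 p.2.1 p.2.2) /\
  v = (if k == 0 then iota t else 0) + \sum_(p <- L | p.1 == k) p.2.1.
Proof.
have [t [x [x' [-> /adjpair_list[L [hL -> _]]]]]] := V_decomp v; move=> hv.
exists t, L; split=> //.
pose L' := (0 : weight, (iota t, iota t)) :: L.
have e' : iota t + \sum_(p <- L) p.2.1 = \sum_(p <- L') p.2.1 by rewrite big_cons.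
rewrite e' in hv *; rewrite (@W_component_map L' id fst k) //.
  by rewrite big_cons /= eq_sym; case: eqP => // _; rewrite add0r.
move=> p; rewrite inE => /orP[/eqP -> /=|/hL/wtpair_W[] //]; exact: W_iota.
Qed.

Lemma W0_iota v : W 0 v -> exists t, v = iota t.
Proof.
move=> /V_component[t [L [hL ->]]]; rewrite eqxx.
elim: L hL => [|p L IH] hL; first by exists t; rewrite big_nil addr0.
have [u hu] := IH (fun q hq => hL q (mem_behead (s := p :: L) hq)).
rewrite big_cons; case: eqP => [p0|_]; last by exists u.
have := hL _ (mem_head _ _); rewrite p0 => -[/pospair_pos/pos0 //|[|[_ [c [-> _]]]]].
  by rewrite oppr0 => /pospair_pos/pos0.
by exists (\sum_i c i *: coroot i + u); rewrite iotaD -hu addrCA.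
Qed.

Lemma W_wtpair k v : W k v -> k != 0 -> v != 0 -> exists v', wtpair k v v'.
Proof.
move=> /V_component[t [L [hL ->]]] /negPf -> ; rewrite add0r.
elim: L hL => [|p L IH] hL; first by rewrite big_nil eqxx.
have {}IH := IH (fun q hq => hL q (mem_behead (s := p :: L) hq)).
rewrite big_cons; have [pk|//] := eqVneq p.1 k; move=> _.
have hp := hL _ (mem_head _ _); rewrite pk in hp.
have [->|/IH[w hw]] := eqVneq (\sum_(q <- L | q.1 == k) q.2.1) 0.
  by exists p.2.2; rewrite addr0.
by exists (1^* *: p.2.2 + w); rewrite -[p.2.1]scale1r; apply: wtpair_lin.
Qed.

Lemma wtpair_pos k x x' : wtpair k x x' -> k != 0 -> pos k \/ pos (- k).
Proof. by case=> [/pospair_pos|[/pospair_pos|[->]]]; rewrite ?eqxx //; [left|right]. Qed.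

Lemma wtpair_ht k x x' : wtpair k x x' -> k != 0 -> ht k != 0.
Proof.
move=> h /(wtpair_pos h) [[_ h']|[_ h']]; first by rewrite gt_eqF.
by rewrite -oppr_eq0 -htN gt_eqF.
Qed.

Lemma W_ht k v : W k v -> v != 0 -> k != 0 -> ht k != 0.
Proof. by move=> h v0 k0; have [v' /wtpair_ht] := W_wtpair h k0 v0; apply. Qed.

Lemma W_pospair k x : W k x -> pos k -> x != 0 -> exists x', pospair k x x'.
Proof.
move=> h hk x0; have k0 : k != 0 by apply/eqP => k0; move: hk; rewrite k0 => /pos0.
have [x' [hx|[/pospair_pos /(pos_opp hk) //|[k1]]]] := W_wtpair h k0 x0; first by exists x'.
by rewrite k1 eqxx in k0.
Qed.

Lemma V_ind (Q : V -> Prop) : (forall x y, Q x -> Q y -> Q (x + y)) ->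
  (forall k x, W k x -> Q x) -> forall v, Q v.
Proof.
move=> QD QW v; have [t [x [x' [-> hx]]]] := V_decomp v.
apply: (QD); first by apply: QW (W_iota t).
elim: hx => {x x'} [|u u' w w' [k /wtpair_W[hu _]] _ IH]; first by apply: (QW 0); apply: W0.
by apply: (QD _ _ (QW _ _ hu) IH).
Qed.

(** A bracket step ending at height 1 would start from a positive weight of height 0, so only
    generators and linear combinations occur. *)
Lemma pospair_ht1 k x x' : pospair k x x' -> ht k = 1 ->
  exists i c, [/\ k = simple_wt i, x = c *: e i & x' = c^* *: f i].
Proof.
elim => {k x x'} [i _|k c x x' y y' _ IH1 _ IH2 hk|k i x x' hx _].
- by exists i, 1; rewrite rmorph1 !scale1r.
- have [i [a [ki -> ->]]] := IH1 hk; have [j [b [kj -> ->]]] := IH2 hk.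
  have ij : i = j.
    have /rowP/(_ i) : simple_wt i = simple_wt j by rewrite -ki.
    by rewrite !mxE !eqxx /=; case: eqP.
  rewrite -{}ij; exists i, (c * a + b); split=> //; first by rewrite scalerA scalerDl.
  by rewrite rmorphD rmorphM scalerA scalerDl.
- move=> /eqP; rewrite htD ht_simple -subr_eq0 addrAC subrr add0r => /eqP h0.
  by case: (pospair_pos hx); rewrite h0 ltxx.
Qed.

(** The generators have height 1, so a pair of larger height is a combination of pairs obtained by a
    last bracket with some [e i]. *)
Lemma pospair_span (Q : V -> V -> Prop) k x x' : semilin_closed Q ->
  (forall i l y y', ht k = 1 + ht l -> pospair l y y' -> Q (br (e i) y) (br y' (f i))) ->
  pospair k x x' -> 1 < ht k -> Q x x'.
Proof.
move=> Qlin Qbr h; elim: h Qbr => {k x x'} [i|k c x x' y y' _ IH1 _ IH2|k i x x' hx _] Qbr hk.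
- by rewrite ht_simple ltxx in hk.
- by apply: Qlin; [apply: IH1|apply: IH2].
- by apply: (Qbr i k); rewrite ?htD ?ht_simple.
Qed.

(** Independence of the simple roots makes the matrix of their values on a basis of [hT] right
    invertible; apply a right inverse to the all-ones vector. The action of [t0] then reads off
    heights. *)
Lemma exists_t0 : exists t0, forall i, alpha i t0 = 1.
Proof.
pose X := vbasis (fullv : {vspace hT}).
pose M : 'M[K]_(n, \dim (fullv : {vspace hT})) := \matrix_(i, j) alpha i X`_j.
have /row_freeP[N MN] : row_free M.
  apply: inj_row_free => v vM; apply/rowP => i; rewrite mxE.
  apply: (@alpha_free (fun i => v 0 i)) => t.
  rewrite (coord_vbasis (memvf t)).
  under eq_bigr => l _ do (rewrite alpha_sum mulr_sumr;
    under eq_bigr => j _ do rewrite alphaZ mulrCA).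
  rewrite exchange_big big1 // => j _; rewrite -mulr_sumr.
  have := congr1 (fun u : 'rV[K]_ _ => u 0 j) vM; rewrite !mxE => h.
  by rewrite (_ : \sum_l _ = 0) ?mulr0 // -[RHS]h; apply: eq_bigr => l _; rewrite mxE.
exists (\sum_j (N *m (const_mx 1 : 'cV[K]_n)) j 0 *: X`_j) => i.
have := congr1 (fun u : 'cV[K]_n => u i 0) (congr1 (mulmx^~ (const_mx 1 : 'cV[K]_n)) MN).
rewrite -mulmxA mul1mx mxE [RHS]mxE => h; rewrite -[RHS]h alpha_sum.
by apply: eq_bigr => j _; rewrite alphaZ [M i j]mxE mulrC.
Qed.

Lemma sum_group (L : seq (weight * V)) :
  \sum_(p <- L) p.2 = \sum_(k <- undup (map fst L)) \sum_(p <- L | p.1 == k) p.2.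
Proof.
rewrite (exchange_big_dep xpredT) //=; apply: eq_big_seq => p pL.
under eq_bigl => k do rewrite eq_sym.
by rewrite big_uniq1 ?undup_uniq // mem_undup; apply: map_f.
Qed.

(** * The invariant bilinear form *)

Section InvariantForm.
Variable t0 : hT.
Hypothesis alpha_t0 : forall i, alpha i t0 = 1.

Lemma wt_t0 k : wt k t0 = (ht k)%:~R.
Proof. by rewrite /wt /ht rmorph_sum; apply: eq_bigr => i _; rewrite alpha_t0 mulr1. Qed.

Definition deg (i : int) x := br (iota t0) x = i%:~R *: x.

(** A complement of the Cartan subalgebra on which [br (iota t0)] acts invertibly; no nonzero weight
    that occurs in [V] has height 0 ([W_ht]). *)
Definition offcartan w := exists L : seq (weight * V),
  (forall p, p \in L -> W p.1 p.2 /\ ht p.1 != 0) /\ w = \sum_(p <- L) p.2.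

Lemma offcartan0 : offcartan 0.
Proof. by exists [::]; rewrite big_nil. Qed.

Lemma offcartanD w w' : offcartan w -> offcartan w' -> offcartan (w + w').
Proof.
move=> [L [hL ->]] [L' [hL' ->]]; exists (L ++ L'); rewrite big_cat; split=> // p.
by rewrite mem_cat => /orP[/hL|/hL'].
Qed.

Lemma offcartan_map (g : weight -> K) w : offcartan w -> exists L : seq (weight * V),
  [/\ forall p, p \in L -> W p.1 p.2 /\ ht p.1 != 0, w = \sum_(p <- L) p.2
    & offcartan (\sum_(p <- L) g p.1 *: p.2)].
Proof.
move=> [L [hL ->]]; exists L; split=> //; exists [seq (p.1, g p.1 *: p.2) | p <- L].
rewrite big_map; split=> // _ /mapP[p /hL[hp h] ->] /=; split=> //; exact: WZ.
Qed.

Lemma offcartanZ a w : offcartan w -> offcartan (a *: w).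
Proof. by case/(offcartan_map (fun _ => a)) => L [_ -> +]; rewrite -scaler_sumr. Qed.

Lemma offcartan_t0 w : offcartan w -> offcartan (br (iota t0) w).
Proof.
case/(offcartan_map (fun k => wt k t0)) => L [hL ->]; rewrite br_sumr.
suff -> : \sum_(p <- L) wt p.1 t0 *: p.2 = \sum_(p <- L) br (iota t0) p.2 by [].
by apply: eq_big_seq => p /hL[-> _].
Qed.

Lemma offcartan_uniq t w : iota t + br (iota t0) w = 0 -> offcartan w -> t = 0 /\ w = 0.
Proof.
move=> + [L [hL ew]]; rewrite {}ew sum_group; set s := undup _.
set X := fun k => \sum_(p <- L | p.1 == k) p.2 => /= h.
have hs k : k \in s -> ht k != 0.
  by rewrite mem_undup => /mapP[p /hL[_ hp] ->].
have hX k : W k (X k).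
  by rewrite /X big_seq_cond; apply: W_sum => p /andP[/hL[+ _] /eqP <-].
have n0s : 0 \notin s by apply/negP => /hs; rewrite ht0 eqxx.
pose X' k := if k == 0 then iota t else (ht k)%:~R *: X k.
have X'E k : k \in s -> X' k = (ht k)%:~R *: X k.
  by rewrite /X'; case: eqP => // ->; rewrite (negPf n0s).
have hX' k : k \in 0 :: s -> W k (X' k).
  by move=> _; rewrite /X'; case: eqP => [->|_]; [apply: W_iota|apply: WZ].
have hsum : \sum_(k <- 0 :: s) X' k = 0.
  rewrite big_cons {1}/X' eqxx -[RHS]h br_sumr; congr (_ + _).
  by apply: eq_big_seq => k ks; rewrite X'E // hX wt_t0.
have us : uniq (0 :: s) by rewrite /= n0s undup_uniq.
have h0 := W_indep us hX' hsum.
split; first by apply: iota_inj; have := h0 _ (mem_head _ _); rewrite /X' eqxx iota0.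
rewrite big1_seq // => k /andP[_ ks]; have := h0 k; rewrite inE ks orbT X'E // => /(_ isT)/eqP.
by rewrite scaler_eq0 intr_eq0 (negPf (hs _ ks)) => /eqP.
Qed.

Lemma cartan_split v : exists tw : hT * V,
  v = iota tw.1 + br (iota t0) tw.2 /\ offcartan tw.2.
Proof.
move: v; apply: V_ind => [_ _ [[t w] /= [-> hw]] [[u w'] /= [-> hw']]|k x hx].
  exists (t + u, w + w') => /=; rewrite iotaD brDr addrACA; split=> //; exact: offcartanD.
have [k0|k0] := eqVneq k 0.
  rewrite k0 in hx; have [t ->] := W0_iota hx; exists (t, 0) => /=.
  by rewrite br0r addr0; split=> //; apply: offcartan0.
have [->|x0] := eqVneq x 0.
  by exists (0, 0); rewrite /= iota0 br0r addr0; split=> //; apply: offcartan0.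
have hk := W_ht hx x0 k0; exists (0, (ht k)%:~R^-1 *: x); rewrite /= iota0 add0r; split.
  by rewrite brZr hx wt_t0 scalerA mulVf ?intr_eq0 // scale1r.
exists [:: (k, (ht k)%:~R^-1 *: x)]; rewrite big_seq1; split=> // p.
by rewrite inE => /eqP -> /=; split=> //; apply: WZ.
Qed.

Definition cartan_proj v : hT := (projT1 (choice cartan_split) v).1.
(** The inverse of the grading derivation [br (iota t0)] off the Cartan subalgebra, extended by
    zero. The splitting is unique ([offcartan_uniq]), so the choice is linear. *)
Definition deg_inv v : V := (projT1 (choice cartan_split) v).2.
Local Notation p0 := cartan_proj.
Local Notation D := deg_inv.

Lemma cartan_splitP v : v = iota (p0 v) + br (iota t0) (D v) /\ offcartan (D v).
Proof. exact: (projT2 (choice cartan_split) v). Qed.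

Lemma cartan_split_eq v t w :
  v = iota t + br (iota t0) w -> offcartan w -> p0 v = t /\ D v = w.
Proof.
have [e1 h1] := cartan_splitP v; move=> e2 h2.
have [] := @offcartan_uniq (p0 v - t) (D v - w).
- by rewrite iotaD iotaN brDr brNr addrACA -opprD -e1 -e2 subrr.
- by rewrite -scaleN1r; apply/offcartanD/offcartanZ.
by move=> /eqP + /eqP; rewrite !subr_eq0 => /eqP -> /eqP ->.
Qed.

Lemma p0D_lin a u v : p0 (a *: u + v) = a *: p0 u + p0 v /\ D (a *: u + v) = a *: D u + D v.
Proof.
have [eu hu] := cartan_splitP u; have [ev hv] := cartan_splitP v.
apply: cartan_split_eq; last by apply/offcartanD => //; apply: offcartanZ.
by rewrite {1}eu {1}ev iota_lin brDr brZr scalerDr addrACA.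
Qed.

Lemma p0_iota t : p0 (iota t) = t /\ D (iota t) = 0.
Proof. by apply: cartan_split_eq offcartan0; rewrite br0r addr0. Qed.

Lemma deg0_iota v : deg 0 v -> v = iota (p0 v).
Proof.
rewrite /deg scale0r; have [e1 h1] := cartan_splitP v.
rewrite {1}e1 brDr br_hh add0r => h.
have [||_ h'] := @offcartan_uniq 0 (br (iota t0) (D v)).
- by rewrite iota0 add0r.
- exact: offcartan_t0.
- by rewrite {1}e1 h' addr0.
Qed.

Lemma deg_split i v : i != 0 -> deg i v -> p0 v = 0 /\ D v = i%:~R^-1 *: v.
Proof.
move=> i0 hv; have [e1 h1] := cartan_splitP v.
have i0' : i%:~R != 0 :> K by rewrite intr_eq0.
have [||+ +] := @offcartan_uniq (i%:~R *: p0 v) (i%:~R *: D v - br (iota t0) (D v)).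
- rewrite brDr brZr brNr iotaZ addrA -scalerDr -e1 -hv {1}e1 brDr br_hh add0r.
  by rewrite subrr.
- by rewrite -scaleN1r; apply/offcartanD/offcartanZ/offcartan_t0 => //; apply: offcartanZ.
move=> /eqP; rewrite scaler_eq0 (negPf i0') => /eqP p0v /eqP; rewrite subr_eq0 => /eqP Dv.
by split=> //; rewrite {2}e1 p0v iota0 add0r -Dv scalerA mulVf // scale1r.
Qed.

Definition phi v := form t0 (p0 v).
(* For [x] of degree [i != 0] this is [form t0 [x, y] / i], the value forced by
   invariance; see [kform_deg]. *)
Definition kform x y := phi (br (D x) y) + form (p0 x) (p0 y).
Local Notation B := kform.

Lemma phi_lin a u v : phi (a *: u + v) = a * phi u + phi v.
Proof. by rewrite /phi; have [-> _] := p0D_lin a u v; rewrite formDr formZr. Qed.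

Lemma phiD u v : phi (u + v) = phi u + phi v.
Proof. by rewrite -[u]scale1r phi_lin scale1r mul1r. Qed.

Lemma phi0 : phi 0 = 0.
Proof. by apply: (addIr (phi 0)); rewrite -phiD !add0r. Qed.

Lemma phiZ a u : phi (a *: u) = a * phi u.
Proof. by rewrite -[a *: u]addr0 phi_lin phi0 addr0. Qed.

Lemma phiN u : phi (- u) = - phi u.
Proof. by rewrite -scaleN1r phiZ mulN1r. Qed.

Lemma phi_iota t : phi (iota t) = form t0 t.
Proof. by rewrite /phi; case: (p0_iota t) => ->. Qed.

Lemma phi_deg i v : i != 0 -> deg i v -> phi v = 0.
Proof. by move=> i0 /(deg_split i0)[p0v _]; rewrite /phi p0v form0r. Qed.

Lemma kform_linl a x y z : B (a *: x + y) z = a * B x z + B y z.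
Proof.
rewrite /B; have [-> ->] := p0D_lin a x y.
by rewrite brDl brZl phi_lin form_lin mulrDr addrACA.
Qed.

Lemma kform_linr a x y z : B z (a *: x + y) = a * B z x + B z y.
Proof.
rewrite /B; have [-> _] := p0D_lin a x y.
by rewrite brDr brZr phi_lin formDr formZr mulrDr addrACA.
Qed.

Lemma kform_iota t u : B (iota t) (iota u) = form t u.
Proof.
rewrite /B; have [-> ->] := p0_iota t; have [-> _] := p0_iota u.
by rewrite br0l phi0 add0r.
Qed.

Lemma deg_br i j x y : deg i x -> deg j y -> deg (i + j) (br x y).
Proof. by move=> hx hy; rewrite /deg jacobi hx hy brZl brZr intrD scalerDl. Qed.

Lemma W_deg k x : W k x -> deg (ht k) x.
Proof. by move=> h; rewrite /deg h wt_t0. Qed.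

Lemma kform_deg i x y : i != 0 -> deg i x -> B x y = i%:~R^-1 * phi (br x y).
Proof.
move=> i0 /(deg_split i0)[h1 h2].
by rewrite /B h1 h2 form0l addr0 brZl phiZ.
Qed.

Lemma kform_deg0 i j x y : i + j != 0 -> deg i x -> deg j y -> B x y = 0.
Proof.
move=> ij hx hy; have [i0|i0] := eqVneq i 0; last first.
  by rewrite (kform_deg _ i0 hx) (phi_deg ij (deg_br hx hy)) mulr0.
rewrite i0 add0r in ij hx; rewrite (deg0_iota hx) /B.
have [_ ->] := p0_iota (p0 x); have [-> _] := deg_split ij hy.
by rewrite br0l phi0 form0r addr0.
Qed.

Lemma kform_symm_deg i j x y : deg i x -> deg j y -> B x y = B y x.
Proof.
move=> hx hy; have [ij|ij] := eqVneq (i + j) 0; last first.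
  by rewrite (kform_deg0 ij hx hy) (@kform_deg0 j i) // addrC.
have [i0|i0] := eqVneq i 0.
  move: hx hy ij; rewrite i0 add0r => hx hy j0; rewrite j0 in hy.
  by rewrite (deg0_iota hx) (deg0_iota hy) !kform_iota formC.
have -> : B x y = i%:~R^-1 * phi (br x y) by apply: kform_deg.
have ji : j = - i by apply/eqP; rewrite -addr_eq0 addrC ij.
rewrite (@kform_deg j) ?ji ?oppr_eq0 -?ji // brC phiN.
by rewrite ji rmorphN invrN mulrN mulNr.
Qed.

Lemma deg_ind (Q : V -> Prop) : (forall x y, Q x -> Q y -> Q (x + y)) ->
  (forall i x, deg i x -> Q x) -> forall v, Q v.
Proof. by move=> QD Qd; apply: V_ind => // k x /W_deg; apply: Qd. Qed.

Lemma kformDl x y z : B (x + y) z = B x z + B y z.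
Proof. by rewrite -[x]scale1r kform_linl scale1r mul1r. Qed.

Lemma kformDr x y z : B z (x + y) = B z x + B z y.
Proof. by rewrite -[x]scale1r kform_linr scale1r mul1r. Qed.

Lemma kformC x y : B x y = B y x.
Proof.
move: x; apply: deg_ind => [x x' hx hx'|i x hx]; first by rewrite kformDl kformDr hx hx'.
move: y; apply: deg_ind => [y y' hy hy'|j y hy]; first by rewrite kformDl kformDr hy hy'.
exact: kform_symm_deg hx hy.
Qed.

Lemma kform0l z : B 0 z = 0.
Proof. by apply: (addIr (B 0 z)); rewrite -kformDl !add0r. Qed.

Lemma kformZl a x z : B (a *: x) z = a * B x z.
Proof. by rewrite -[a *: x]addr0 kform_linl kform0l addr0. Qed.

Lemma kformNl x z : B (- x) z = - B x z.
Proof. by rewrite -scaleN1r kformZl mulN1r. Qed.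

Lemma phi_br i j x y : deg i x -> deg j y -> phi (br x y) = i%:~R * B x y.
Proof.
move=> hx hy; have [i0|i0] := eqVneq i 0; last first.
  by rewrite (kform_deg _ i0 hx) mulrA mulfV ?intr_eq0 // mul1r.
rewrite i0 in hx *; rewrite mul0r; have [j0|j0] := eqVneq j 0.
  by rewrite j0 in hy; rewrite (deg0_iota hx) (deg0_iota hy) br_hh phi0.
by have := deg_br hx hy; rewrite add0r; apply: phi_deg.
Qed.

(** For a symmetric form this expresses invariance on the triple. The cyclic shape survives every
    permutation of the arguments, so one order of the degrees gives all of them. *)
Definition cyclic x y z := B (br x y) z = B (br y z) x /\ B (br y z) x = B (br z x) y.

Lemma cyclic_rot x y z : cyclic x y z -> cyclic y z x.
Proof. by move=> [h1 h2]; split=> //; rewrite h1 h2. Qed.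

Lemma cyclic_swap x y z : cyclic x y z -> cyclic y x z.
Proof.
move=> [h1 h2]; rewrite /cyclic [br y x]brC [br x z]brC [br z y]brC.
by rewrite !kformNl h1 h2.
Qed.

Lemma cyclic_linl a x x' y z : cyclic x y z -> cyclic x' y z -> cyclic (a *: x + x') y z.
Proof.
move=> [h1 h2] [h3 h4]; rewrite /cyclic brDl brDr brZl brZr !kform_linl !kform_linr.
by rewrite h1 h2 h3 h4.
Qed.

Lemma cyclic_linr a x y z z' : cyclic x y z -> cyclic x y z' -> cyclic x y (a *: z + z').
Proof.
move=> /cyclic_rot/cyclic_rot h /cyclic_rot/cyclic_rot h'; apply: cyclic_rot.
exact: cyclic_linl.
Qed.

Lemma cyclic0l y z : cyclic 0 y z.
Proof. by rewrite /cyclic br0l br0r !kform0l kformC kform0l. Qed.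

(** Apply [phi] to the Jacobi identity. The result is one linear relation between the three cyclic
    values, so an equality between two of them yields the third when its coefficient is nonzero. *)
Lemma kform_jacobi i j k x y z : i + j + k = 0 -> deg i x -> deg j y -> deg k z ->
  k%:~R * B (br x y) z + i%:~R * B (br y z) x + j%:~R * B (br z x) y = 0.
Proof.
move=> ijk hx hy hz; have /eqP := congr1 phi (jacobi_sum x y z).
rewrite !phiD phi0.
rewrite (phi_br (deg_br hx hy) hz) (phi_br (deg_br hy hz) hx) (phi_br (deg_br hz hx) hy).
have -> : i + j = - k by lia.
have -> : j + k = - i by lia.
have -> : k + i = - j by lia.
by rewrite !rmorphN !mulNr -!opprD oppr_eq0 => /eqP.
Qed.

(** [x] is a multiple of [deg_inv x], which is a finite sum of weight vectors; independence kills
    the components whose height is not [N]. *)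
Lemma deg_sum N x (Q : V -> Prop) : N != 0 -> deg N x ->
  (forall x y, Q x -> Q y -> Q (x + y)) -> Q 0 ->
  (forall k y, ht k = N -> W k y -> Q y) -> Q x.
Proof.
move=> N0 hx QD Q0 QW; have [_ [L [hL eL]]] := cartan_splitP x.
have NK : N%:~R != 0 :> K by rewrite intr_eq0.
have -> : x = N%:~R *: D x.
  by have [_ ->] := deg_split N0 hx; rewrite scalerA mulfV // scale1r.
have hD : deg N (D x).
  have [_ ->] := deg_split N0 hx; rewrite /deg brZr hx !scalerA mulrC //.
rewrite eL sum_group in hD *; set s := undup _ in hD *.
have hX k : W k (\sum_(p <- L | p.1 == k) p.2).
  by rewrite big_seq_cond; apply: W_sum => p /andP[/hL[+ _] /eqP <-].
have hs : \sum_(k <- s) ((ht k)%:~R - N%:~R) *: \sum_(p <- L | p.1 == k) p.2 = 0.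
  move: hD; rewrite /deg br_sumr scaler_sumr => /eqP; rewrite -subr_eq0 -sumrB => /eqP hD.
  by rewrite -[RHS]hD; apply: eq_bigr => k _; rewrite hX wt_t0 scalerBl.
have := W_indep (undup_uniq _) _ hs => /(_ (fun k _ => WZ _ (hX k))) h0.
rewrite scaler_sumr big_seq; apply: big_ind => // k /h0/eqP.
rewrite scaler_eq0 subr_eq0 eqr_int => /orP[/eqP hk|/eqP ->]; last by rewrite scaler0.
by apply: (QW k) => //; apply: WZ.
Qed.

Lemma deg_span_pos N x (Q : V -> Prop) : 1 < N -> deg N x ->
  (forall c x y, Q x -> Q y -> Q (c *: x + y)) -> Q 0 ->
  (forall i j y z, 0 < i -> 0 < j -> i + j = N -> deg i y -> deg j z -> Q (br y z)) -> Q x.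
Proof.
move=> N1 hx Qlin Q0 Qbr; apply: (deg_sum _ hx) => //; first lia.
  by move=> u v hu hv; rewrite -[u]scale1r; apply: Qlin.
move=> k y hk hy; have [->//|y0] := eqVneq y 0.
have k0 : k != 0 by apply/eqP => k0; rewrite k0 ht0 in hk; lia.
have [y' [h|[/pospair_pos[_]|[k1]]]] := W_wtpair hy k0 y0; last by rewrite k1 eqxx in k0.
  apply: (@pospair_span (fun u _ => Q u) k y y') => //; last by rewrite hk.
    by move=> c u _ v _; apply: Qlin.
  move=> i l u u' hl hu; have hlp := pospair_pos hu; have [hu1 _] := pospair_W hu.
  apply: (Qbr 1 (ht l)); rewrite -?hk ?hl //; first by case: hlp.
    by rewrite -(ht_simple i); apply/W_deg/W_e.
  exact: W_deg.
by rewrite htN hk; lia.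
Qed.

Lemma deg_span_neg N x (Q : V -> Prop) : 1 < N -> deg (- N) x ->
  (forall c x y, Q x -> Q y -> Q (c *: x + y)) -> Q 0 ->
  (forall i j y z, i < 0 -> j < 0 -> i + j = - N -> deg i y -> deg j z -> Q (br y z)) -> Q x.
Proof.
move=> N1 hx Qlin Q0 Qbr; apply: (deg_sum _ hx) => //; first lia.
  by move=> u v hu hv; rewrite -[u]scale1r; apply: Qlin.
move=> k y hk hy; have [->//|y0] := eqVneq y 0.
have k0 : k != 0 by apply/eqP => k0; rewrite k0 ht0 in hk; lia.
have [y' [/pospair_pos[_]|[h|[k1]]]] := W_wtpair hy k0 y0; last by rewrite k1 eqxx in k0.
  by rewrite hk; lia.
apply: (@pospair_span (fun _ u => Q u) (- k) y' y) => //; last by rewrite htN hk opprK.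
  by move=> c u u' v v'; apply: Qlin.
move=> i l u u' hl hu; have [_ hlp] := pospair_pos hu; have [_ hu1] := pospair_W hu.
have hki : ht k = - ht l - 1 by move: hl; rewrite htN; lia.
apply: (Qbr (- ht l) (- 1)) => //; try lia.
  by rewrite -htN; apply: W_deg.
by rewrite -(ht_simple i) -htN; apply/W_deg/W_f.
Qed.

Lemma deg_span1 x (Q : V -> Prop) : deg 1 x ->
  (forall c x y, Q x -> Q y -> Q (c *: x + y)) -> Q 0 -> (forall i, Q (e i)) -> Q x.
Proof.
move=> hx Qlin Q0 Qe; apply: (deg_sum _ hx) => //.
  by move=> u v hu hv; rewrite -[u]scale1r; apply: Qlin.
move=> k y hk hy; have [->//|y0] := eqVneq y 0.
have k0 : k != 0 by apply/eqP => k0; rewrite k0 ht0 in hk.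
have [y' [h|[/pospair_pos[_]|[k1]]]] := W_wtpair hy k0 y0; last by rewrite k1 eqxx in k0.
  have [i [c [_ -> _]]] := pospair_ht1 h hk.
  by rewrite -[_ *: _]addr0; apply: Qlin.
by rewrite htN hk.
Qed.

Lemma deg_spanN1 x (Q : V -> Prop) : deg (- 1) x ->
  (forall c x y, Q x -> Q y -> Q (c *: x + y)) -> Q 0 -> (forall i, Q (f i)) -> Q x.
Proof.
move=> hx Qlin Q0 Qf; apply: (deg_sum _ hx) => //.
  by move=> u v hu hv; rewrite -[u]scale1r; apply: Qlin.
move=> k y hk hy; have [->//|y0] := eqVneq y 0.
have k0 : k != 0 by apply/eqP => k0; rewrite k0 ht0 in hk.
have [y' [/pospair_pos[_]|[h|[k1]]]] := W_wtpair hy k0 y0; last by rewrite k1 eqxx in k0.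
  by rewrite hk.
have [|i [c [_ _ ->]]] := pospair_ht1 h; first by rewrite htN hk.
by rewrite -[_ *: _]addr0; apply: Qlin.
Qed.

(** * Invariance of the form, by induction on a bound for the degrees *)

Definition cyclic_deg i j k := forall x y z, deg i x -> deg j y -> deg k z -> cyclic x y z.

Lemma cyclic_deg_rot i j k : cyclic_deg i j k -> cyclic_deg j k i.
Proof. by move=> h x y z hx hy hz; apply/cyclic_rot/h. Qed.

Lemma cyclic_deg_swap i j k : cyclic_deg i j k -> cyclic_deg j i k.
Proof. by move=> h x y z hx hy hz; apply/cyclic_swap/h. Qed.

Definition cyclic_upto (N : int) := forall i j k,
  - N <= i <= N -> - N <= j <= N -> - N <= k <= N -> cyclic_deg i j k.

Section InvarianceStep.
Variable N : int.
Hypothesis N_gt1 : 1 < N.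
Hypothesis IH : cyclic_upto (N - 1).

(** Jacobi breaks up the bracket with the element of degree [- N], here [u, v]; every triple left
    has degrees smaller than [N] in size, where invariance is already known. *)
Lemma kform_move i j p q x y u v : 0 < i -> 0 < j -> i + j = N ->
  p < 0 -> q < 0 -> p + q = - N -> deg i x -> deg j y -> deg p u -> deg q v ->
  B (br y (br u v)) x = B (br (br x y) u) v.
Proof.
move=> i0 j0 ij p0 q0 pq hx hy hu hv.
rewrite [br y _]jacobi [br (br x y) u]jacobil kformDl.
have [-> ->] : cyclic (br y u) v x.
  by apply: (IH _ _ _ (deg_br hy hu) hv hx); lia.
have [-> ->] : cyclic u (br y v) x.
  by apply: (IH _ _ _ hu (deg_br hy hv) hx); lia.
rewrite [br y (br x u)]brC opprK kformDl; congr (_ + _); rewrite kformC.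
by have [-> ->] : cyclic y v (br x u) by apply: (IH _ _ _ hy hv (deg_br hx hu)); lia.
Qed.

Lemma cyclic_deg_step i j p q x y u v : 0 < i -> 0 < j -> i + j = N ->
  p < 0 -> q < 0 -> p + q = - N -> deg i x -> deg j y -> deg p u -> deg q v ->
  cyclic x y (br u v) /\ cyclic u v (br x y).
Proof.
move=> i0 j0 ij p0 q0 pq hx hy hu hv.
have N0 : N%:~R != 0 :> K by rewrite intr_eq0; lia.
have h1 := kform_move i0 j0 ij p0 q0 pq hx hy hu hv.
have h2 : B (br (br u v) x) y = B (br (br x y) u) v.
  rewrite [br _ x]brC kformNl (kform_move j0 i0 _ p0 q0 pq hy hx hu hv); last by rewrite addrC.
  by rewrite [br y x]brC brNl kformNl opprK.
have h3 : B (br v (br x y)) u = B (br (br x y) u) v.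
  rewrite [br v _]brC kformNl -(kform_move i0 j0 ij q0 p0 _ hx hy hv hu); last by rewrite addrC.
  by rewrite [br v u]brC brNr kformNl opprK.
have hN : i + j + (p + q) = 0 by rewrite ij pq subrr.
(* Two cyclic values agree by [h1] and [h2], so this relation equates [N] times the third with [N]
   times their common value. *)
have := kform_jacobi hN hx hy (deg_br hu hv).
rewrite h1 h2 pq -addrA -mulrDl -rmorphD ij rmorphN mulNr addrC => /eqP.
rewrite subr_eq0 => /eqP/(mulfI N0) h4.
by split; rewrite /cyclic ?h1 ?h2 ?h3 // kformC -h4.
Qed.

Lemma cyclic0r x y : cyclic x y 0.
Proof. by apply: cyclic_rot; apply: cyclic0l. Qed.

Lemma cyclic_deg_pos i j : 0 < i -> 0 < j -> i + j = N -> cyclic_deg i j (- N).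
Proof.
move=> i0 j0 ij x y z hx hy hz.
apply: (@deg_span_neg N z (fun z => cyclic x y z)) => // [c u v| |p q u v p0 q0 pq hu hv].
- exact: cyclic_linr.
- exact: cyclic0r.
- by case: (cyclic_deg_step i0 j0 ij p0 q0 pq hx hy hu hv).
Qed.

Lemma cyclic_deg_neg p q : p < 0 -> q < 0 -> p + q = - N -> cyclic_deg p q N.
Proof.
move=> p0 q0 pq u v w hu hv hw.
apply: (@deg_span_pos N w (fun w => cyclic u v w)) => // [c x y| |i j x y i0 j0 ij hx hy].
- exact: cyclic_linr.
- exact: cyclic0r.
- by case: (cyclic_deg_step i0 j0 ij p0 q0 pq hx hy hu hv).
Qed.

(** With a Cartan element as first argument the preceding step does not apply, as it needs two
    positive degrees. Splitting [x] as [a, b] reduces to smaller degrees and to [cyclic_deg_pos]. *)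
Lemma cyclic_cartan : cyclic_deg 0 N (- N).
Proof.
move=> h x z hh hx hz; have eh := deg0_iota hh; rewrite eh in hh *; set t := p0 h in hh *.
apply: (@deg_span_pos N x (fun x => cyclic (iota t) x z)) => //
  [c u v|| i j a b i0 j0 ij ha hb].
- by move=> /cyclic_swap + /cyclic_swap; move=> h1 h2; apply/cyclic_swap/cyclic_linl.
- by apply: cyclic_swap; apply: cyclic0l.
have degt k w : deg k w -> deg k (br (iota t) w) by move=> hw; rewrite -[k]add0r; apply: deg_br.
have N0 : N%:~R != 0 :> K by rewrite intr_eq0; lia.
have hN : 0 + N - N = 0 by rewrite add0r subrr.
have hab : deg N (br a b) by rewrite -ij; apply: deg_br.
have h1 : B (br (br a b) z) (iota t) = B (br (iota t) (br a b)) z.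
  rewrite [br (br a b) z]jacobil [br (iota t) _]jacobi !kformDl kformNl.
  have [-> ->] : cyclic a (br b z) (iota t) by apply: (IH _ _ _ ha (deg_br hb hz) hh); lia.
  have [-> ->] : cyclic b (br a z) (iota t) by apply: (IH _ _ _ hb (deg_br ha hz) hh); lia.
  have [-> _] : cyclic (br (iota t) a) b z.
    by apply: (cyclic_deg_pos i0 j0 ij (degt _ _ ha) hb hz).
  rewrite [br a (br (iota t) b)]brC kformNl.
  have [-> _] : cyclic (br (iota t) b) a z.
    by apply: (cyclic_deg_pos j0 i0 _ (degt _ _ hb) ha hz); rewrite addrC.
  by rewrite kformC [B (br _ b) _]kformC.
have := kform_jacobi hN hh hab hz.
rewrite mul0r addr0 rmorphN mulNr addrC => /eqP; rewrite subr_eq0 => /eqP/(mulfI N0) h2.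
by rewrite /cyclic h1 h2.
Qed.
End InvarianceStep.

(** In degree 1 nothing can be split, and [form_coroot] enters: for equal indices both sides are
    alpha_i(t) eps_i, which is the compatibility of the form on h with the Cartan matrix. *)
Lemma cyclic_cartan1 : cyclic_deg 0 1 (- 1).
Proof.
move=> h x z hh hx hz; have eh := deg0_iota hh; rewrite eh in hh *; set t := p0 h in hh *.
apply: (@deg_span1 x (fun x => cyclic (iota t) x z)) => // [c u v||i].
- by move=> /cyclic_swap + /cyclic_swap; move=> h1 h2; apply/cyclic_swap/cyclic_linl.
- by apply: cyclic_swap; apply: cyclic0l.
apply: (@deg_spanN1 z (fun z => cyclic (iota t) (e i) z)) => // [c u v||j].
- exact: cyclic_linr.
- exact: cyclic0r.
have he : deg 1 (e i) by rewrite -(ht_simple i); apply/W_deg/W_e.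
have hf : deg (- 1) (f j) by rewrite -(ht_simple j) -htN; apply/W_deg/W_f.
have h1 : B (br (e i) (f j)) (iota t) = B (br (iota t) (e i)) (f j).
  rewrite br_he kformZl (kform_deg _ _ he) // invr1 mul1r br_ef.
  case: eqP => [_|_]; last by rewrite kform0l phi0 mulr0.
  by rewrite kform_iota phi_iota form_coroot [form t0 _]formC form_coroot alpha_t0 mul1r.
have := @kform_jacobi 0 1 (- 1) _ _ _ erefl hh he hf.
rewrite mul0r addr0 rmorphN rmorph1 mulN1r mul1r addrC => /eqP; rewrite subr_eq0 => /eqP h2.
by rewrite /cyclic h1 h2.
Qed.

Lemma cyclic_deg_neq0 i j k : i + j + k != 0 -> cyclic_deg i j k.
Proof.
move=> h x y z hx hy hz; rewrite /cyclic.
rewrite (kform_deg0 h (deg_br hx hy) hz).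
by rewrite (@kform_deg0 _ _ (br y z) x _ (deg_br hy hz) hx) ?(@kform_deg0 _ _ (br z x) y _ (deg_br hz hx) hy) //; lia.
Qed.

Lemma cyclic_upto_all (N : nat) : cyclic_upto N%:Z.
Proof.
elim: N => [|N IH] i j k.
  move=> hi hj hk x y z; have -> : i = 0 by lia.
  have -> : j = 0 by lia.
  have -> : k = 0 by lia.
  move=> /deg0_iota -> /deg0_iota -> /deg0_iota ->.
  by rewrite /cyclic !br_hh !kform0l.
set M := N.+1%:Z => hi hj hk.
have {}IH : cyclic_upto (M - 1) by have -> : M - 1 = N%:Z by rewrite /M; lia.
have M0 : 0 < M by [].
have h0 : cyclic_deg 0 M (- M).
  have [M1|M1] := ltP 1 M; first exact: cyclic_cartan.
  have -> : M = 1 by lia.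
  exact: cyclic_cartan1.
have hpos a b : 0 <= a -> 0 <= b -> a + b = M -> cyclic_deg a b (- M).
  move=> a0 b0 ab; have [a1|a1] := eqVneq a 0.
    by rewrite a1; have -> : b = M by lia.
  have [b1|b1] := eqVneq b 0.
    rewrite b1; have -> : a = M by lia.
    exact: cyclic_deg_swap.
  by apply: cyclic_deg_pos; lia || exact: IH.
have hneg a b : a <= 0 -> b <= 0 -> a + b = - M -> cyclic_deg a b M.
  move=> a0 b0 ab; have [a1|a1] := eqVneq a 0.
    rewrite a1; have -> : b = - M by lia.
    by do 2! apply: cyclic_deg_rot; apply: cyclic_deg_swap; apply: cyclic_deg_rot.
  have [b1|b1] := eqVneq b 0.
    rewrite b1; have -> : a = - M by lia.
    by do 2! apply: cyclic_deg_rot.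
  by apply: cyclic_deg_neg; lia || exact: IH.
have [ijk|] := eqVneq (i + j + k) 0; last exact: cyclic_deg_neq0.
(* When [c] is extreme, the bounds and the zero sum force [a] and [b] to have the sign opposite to
   [c], possibly with one of them zero. *)
have hM a b c : - M <= a <= M -> - M <= b <= M -> a + b + c = 0 ->
    c = M \/ c = - M -> cyclic_deg a b c.
  by move=> ha hb abc [ec|ec]; rewrite ec in abc *; [apply: hneg|apply: hpos]; lia.
have [k1|k1] := boolP ((k == M) || (k == - M)); first by apply: hM; lia.
have [j1|j1] := boolP ((j == M) || (j == - M)).
  by apply: cyclic_deg_rot; apply: hM; lia.
have [i1|i1] := boolP ((i == M) || (i == - M)).
  by do 2! apply: cyclic_deg_rot; apply: hM; lia.
by apply: IH; lia.
Qed.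

Lemma kform_inv x y z : B (br x y) z = B x (br y z).
Proof.
move: x; apply: deg_ind => [x x' hx hx'|i x hx]; first by rewrite brDl !kformDl hx hx'.
move: y; apply: deg_ind => [y y' hy hy'|j y hy].
  by rewrite brDr brDl kformDl kformDr hy hy'.
move: z; apply: deg_ind => [z z' hz hz'|k z hz]; first by rewrite brDr !kformDr hz hz'.
rewrite [RHS]kformC.
by have [||| ->] := @cyclic_upto_all (`|i| + `|j| + `|k|)%N i j k _ _ _ x y z hx hy hz => //; lia.
Qed.
End InvariantForm.

Lemma exists_invariant_form : exists B : V -> V -> K,
  [/\ forall a x y z, B (a *: x + y) z = a * B x z + B y z,
      forall x y, B x y = B y x,
      forall x y z, B (br x y) z = B x (br y z)
    & forall t u, B (iota t) (iota u) = form t u].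
Proof.
have [t0 ht0] := exists_t0; exists (kform ht0); split.
- exact: kform_linl.
- exact: kformC.
- exact: kform_inv.
- exact: kform_iota.
Qed.

(** * The contravariant Hermitian form *)

Section Contravariant.
Variable B : V -> V -> K.
Hypothesis B_linl : forall a x y z, B (a *: x + y) z = a * B x z + B y z.
Hypothesis BC : forall x y, B x y = B y x.
Hypothesis B_inv : forall x y z, B (br x y) z = B x (br y z).
Hypothesis B_iota : forall t u, B (iota t) (iota u) = form t u.

Lemma B_Dl x y z : B (x + y) z = B x z + B y z.
Proof. by rewrite -[x]scale1r B_linl scale1r mul1r. Qed.

Lemma B_Dr x y z : B z (x + y) = B z x + B z y.
Proof. by rewrite ![B z _]BC B_Dl. Qed.

Lemma B0l z : B 0 z = 0.
Proof. by apply: (addIr (B 0 z)); rewrite -B_Dl !add0r. Qed.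

Lemma B0r z : B z 0 = 0.
Proof. by rewrite BC B0l. Qed.

Lemma B_Zl a x z : B (a *: x) z = a * B x z.
Proof. by rewrite -[a *: x]addr0 B_linl B0l addr0. Qed.

Lemma B_Zr a x z : B z (a *: x) = a * B z x.
Proof. by rewrite BC B_Zl BC. Qed.

Lemma B_Nl x z : B (- x) z = - B x z.
Proof. by rewrite -scaleN1r B_Zl mulN1r. Qed.

Lemma B_Nr x z : B z (- x) = - B z x.
Proof. by rewrite BC B_Nl BC. Qed.

Lemma B_suml (I : Type) (r : seq I) (Q : pred I) (F : I -> V) z :
  B (\sum_(i <- r | Q i) F i) z = \sum_(i <- r | Q i) B (F i) z.
Proof. by apply: (big_morph (B^~ z)) => [x y|]; rewrite ?B_Dl ?B0l. Qed.

Lemma B_sumr (I : Type) (r : seq I) (Q : pred I) (F : I -> V) z :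
  B z (\sum_(i <- r | Q i) F i) = \sum_(i <- r | Q i) B z (F i).
Proof. by rewrite BC B_suml; apply: eq_bigr => i _; rewrite BC. Qed.

Lemma B_inv_swap x y z : B (br x y) z = - B y (br x z).
Proof. by rewrite brC B_Nl B_inv. Qed.

Lemma B_wt k l x y : W k x -> W l y -> k + l != 0 -> B x y = 0.
Proof.
move=> hx hy /wt_sep[t]; rewrite wt0 => ht.
have : wt (k + l) t * B x y = 0.
  by rewrite wtD mulrDl -B_Zl -hx B_inv_swap hy B_Zr addNr.
by move/eqP; rewrite mulf_eq0 (negPf ht) => /eqP.
Qed.

Lemma simple_wt_inj : injective simple_wt.
Proof.
move=> i j /rowP/(_ j); rewrite !mxE !eqxx /= => h.
by apply/esym/eqP; move: h; case: (j == i).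
Qed.

Lemma B_ef i j : B (e i) (f j) = if i == j then eps i else 0.
Proof.
case: eqP => [<-|ij]; last first.
  apply: (B_wt (W_e i) (W_f j)); rewrite subr_eq0; apply/eqP => /simple_wt_inj; exact: ij.
have [t ht] := exists_t0.
have : B (br (iota t) (e i)) (f i) = B (iota t) (br (e i) (f i)) by rewrite B_inv.
by rewrite br_he br_ef eqxx B_Zl B_iota formC form_coroot ht !mul1r.
Qed.

(** The radical of an invariant form is an ideal, and nondegeneracy on h makes it meet the Cartan
    subalgebra trivially. *)
Lemma B_nondeg x : (forall y, B x y = 0) -> x = 0.
Proof.
move: x; apply: no_ideal => [|t h].
  split=> [|x y hy z]; last by rewrite B_inv_swap hy oppr0.
  by split=> [y|a x y hx hy z]; rewrite ?B0l // B_linl hx hy mulr0 addr0.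
suff -> : t = 0 by rewrite iota0.
by apply: form_nondeg => u; rewrite -B_iota h.
Qed.

Lemma B_nondeg_wt k x : W k x -> (forall z, W (- k) z -> B x z = 0) -> x = 0.
Proof.
move=> hx h; apply: B_nondeg; apply: V_ind => [y z hy hz|l y hy].
  by rewrite B_Dr hy hz addr0.
have [kl|kl] := eqVneq (k + l) 0; last exact: B_wt hx hy kl.
by apply: h; have -> : - k = l by apply/eqP; rewrite eq_sym -addr_eq0 addrC kl.
Qed.

Lemma form_inj t u : (forall w, form t w = form u w) -> t = u.
Proof.
move=> h; apply/eqP; rewrite -subr_eq0; apply/eqP/form_nondeg => w.
by rewrite formDl -scaleN1r formZl mulN1r h subrr.
Qed.

Lemma br_opp k x y h : W k x -> W (- k) y -> (forall t, form h t = wt k t) ->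
  br x y = B x y *: iota h.
Proof.
move=> hx hy hh; have [u hu] : exists u, br x y = iota u.
  by apply: W0_iota; rewrite -(subrr k); apply: W_br.
rewrite hu -iotaZ; congr iota; apply: form_inj => t.
rewrite -B_iota -hu B_inv brC hy wtN scaleNr opprK formZl hh B_Zr.
by rewrite mulrC.
Qed.

(** The element of h representing [wt k] under the form; [coroot i] represents eps_i alpha_i, whence
    the division. *)
Definition nu (k : weight) := \sum_i ((k 0 i)%:~R / eps i) *: coroot i.
Definition sform (k l : weight) := wt k (nu l).

Lemma form_nu k t : form (nu k) t = wt k t.
Proof.
rewrite formC /nu /wt; elim/big_ind2: _ => [|t1 c1 t2 c2 h1 h2|i _]; rewrite ?form0r //.
  by rewrite formDr h1 h2.
by rewrite formZr formC form_coroot mulrACA mulVf ?mulr1 ?gt_eqF.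
Qed.

Lemma sformC k l : sform k l = sform l k.
Proof. by rewrite /sform -!form_nu formC. Qed.

Lemma sformDl k k' l : sform (k + k') l = sform k l + sform k' l.
Proof. by rewrite /sform wtD. Qed.

Lemma sformDr k l l' : sform k (l + l') = sform k l + sform k l'.
Proof. by rewrite !(sformC k) sformDl. Qed.

Lemma sformNl k l : sform (- k) l = - sform k l.
Proof. by rewrite /sform wtN. Qed.

Lemma wt_arg0 k : wt k 0 = 0.
Proof. by rewrite /wt big1 // => i _; rewrite alpha0 mulr0. Qed.

Lemma wt_sum_arg k (I : Type) (r : seq I) (Q : pred I) (F : I -> hT) :
  wt k (\sum_(i <- r | Q i) F i) = \sum_(i <- r | Q i) wt k (F i).
Proof.
apply: (big_morph (wt k) _ (wt_arg0 k)) => t u.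
by rewrite -[t]scale1r wt_lin mul1r scale1r.
Qed.

Lemma sformE k l : sform k l = \sum_i (l 0 i)%:~R / eps i * wt k (coroot i).
Proof.
rewrite /sform /nu wt_sum_arg; apply: eq_bigr => i _.
by rewrite -[_ *: _]addr0 wt_lin wt_arg0 addr0.
Qed.

Lemma sform_simple k i : sform k (simple_wt i) = wt k (coroot i) / eps i.
Proof.
rewrite sformE (bigD1 i) //= big1 => [|j ji]; first by rewrite mxE !eqxx addr0 mul1r mulrC.
by rewrite mxE (negPf ji) andbF !mul0r.
Qed.

Lemma conj_eps i : (eps i)^* = eps i.
Proof. by apply/CrealP/gtr0_real. Qed.

Lemma br_oppE k x y : W k x -> W (- k) y -> br x y = B x y *: iota (nu k).
Proof. by move=> hx hy; apply: br_opp (form_nu k). Qed.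

(** Hermitian symmetry of the contravariant form, stated for one pair against all others so that it
    propagates along brackets. *)
Definition hermitian x x' := forall y y', adjpair y y' -> B x' y = (B x y')^*.

Lemma hermitian_sym x x' : hermitian x x' -> hermitian x' x.
Proof. by move=> h y y' /adjpair_sym hy; rewrite (h _ _ hy) conjCK. Qed.

Lemma hermitian_lin : semilin_closed hermitian.
Proof.
move=> c x x' y y' hx hy z z' hz.
by rewrite !B_linl (hx _ _ hz) (hy _ _ hz) rmorphD rmorphM.
Qed.

Lemma hermitian_br x x' z z' :
  hermitian x x' -> adjpair z z' -> hermitian (br x z) (br z' x').
Proof.
move=> hx hz y y' hy; rewrite B_inv_swap (hx _ _ (adjpair_br (adjpair_sym hz) hy)).
by rewrite B_inv [br z y']brC B_Nr rmorphN.
Qed.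

Lemma hermitian_pieces x x' :
  (forall k y y', wtpair k y y' -> B x' y = (B x y')^*) -> hermitian x x'.
Proof.
move=> h y y'; elim=> [|u u' v v' [k hu] _ IH]; first by rewrite !B0r rmorph0.
by rewrite !B_Dr (h _ _ _ hu) IH rmorphD.
Qed.

Lemma hermitian_e i : hermitian (e i) (f i).
Proof.
apply: hermitian_pieces => k y y' hy; have [hy1 hy2] := wtpair_W hy.
have [ki|ki] := eqVneq k (simple_wt i); last first.
  rewrite (B_wt (W_f i) hy1) ?(B_wt (W_e i) hy2) ?rmorph0 //.
    by rewrite subr_eq0 eq_sym.
  by rewrite addrC subr_eq0.
move: hy; rewrite ki => -[h|[/pospair_pos[_]|[k0]]].
- have [j [c [/simple_wt_inj <- -> ->]]] := pospair_ht1 h (ht_simple i).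
  by rewrite !B_Zr [B (f i) _]BC B_ef eqxx rmorphM /= conjCK conj_eps.
- by rewrite htN ht_simple.
- by have := ht_simple i; rewrite k0 ht0.
Qed.

Lemma hermitian_h x x' : hpair x x' -> hermitian x x'.
Proof.
move=> [c [-> ->]]; apply: hermitian_pieces => k y y' hy.
have [hy1 hy2] := wtpair_W hy.
have [k0|k0] := eqVneq k 0; last first.
  rewrite (B_wt (W_iota _) hy1) ?add0r // (B_wt (W_iota _) hy2) ?rmorph0 //.
  by rewrite add0r oppr_eq0.
move: hy; rewrite k0 => -[/pospair_pos/pos0//|[|[_ [d [-> ->]]]]].
  by rewrite oppr0 => /pospair_pos/pos0.
have form_sum a t : form (\sum_i a i *: coroot i) t = \sum_i a i * (alpha i t * eps i).
  elim/big_ind2: _ => [|t1 c1 t2 c2 h1 h2|i _]; rewrite ?form0l ?formDl //.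
    by rewrite h1 h2.
  by rewrite formZl form_coroot.
rewrite !B_iota !form_sum rmorph_sum; apply: eq_bigr => i _.
rewrite [RHS]rmorphM /= [in RHS]rmorphM /= conj_eps conj_alpha.
by under [in RHS]eq_bigr do rewrite conjCK.
Qed.

Lemma adjpair_hermitian x x' : adjpair x x' -> hermitian x x'.
Proof.
have hpos k y y' : pospair k y y' -> hermitian y y'.
  elim=> {k y y'} [i|k c y y' z z' _ h1 _ h2|k i y y' hy _]; first exact: hermitian_e.
    exact: hermitian_lin.
  by apply: hermitian_br (hermitian_e i) _; apply: (@adjpair_wt k); left.
elim=> [|u u' v v' [k hu] _ IH]; first by move=> y y' _; rewrite !B0l rmorph0.
rewrite -[u]scale1r -[u']scale1r -{2}(rmorph1 Num.conj); apply: hermitian_lin => //.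
case: hu => [/hpos//|[/hpos/hermitian_sym//|[_ h]]]; exact: hermitian_h.
Qed.

(** * Integrability *)

Lemma htMn k r : ht (k *+ r) = ht k *+ r.
Proof. by elim: r => [|r IH]; rewrite ?mulr0n ?ht0 // !mulrS htD IH. Qed.

(** Above height 1 the opposite weight space is spanned by brackets with some [f i], to which [z] is
    orthogonal by invariance, so nondegeneracy applies. At height 1, [z] is c e_i and its bracket
    with [f i] is -c times a nonzero coroot. *)
Lemma f_killed_eq0 k z : W k z -> pos k -> (forall i, br (f i) z = 0) -> z = 0.
Proof.
move=> hz hk hf; have [->//|z0] := eqVneq z 0.
have k0 : k != 0 by apply/eqP => k0; move: hk; rewrite k0 => /pos0.
apply: (B_nondeg_wt hz) => y hy; have [->|y0] := eqVneq y 0; first by rewrite B0r.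
have nk0 : - k != 0 by rewrite oppr_eq0.
have [y' [/pospair_pos/(pos_opp hk)//|[|[/eqP]]]] := W_wtpair hy nk0 y0;
  last by rewrite oppr_eq0 (negPf k0).
rewrite opprK => hy'; have [k1|k1] := ltP 1 (ht k).
  apply: (@pospair_span (fun _ y => B z y = 0) k y' y) => // [c u u' v v' h h'|i l u u' _ _].
    by rewrite B_Dr B_Zr h h' mulr0 addr0.
  by rewrite brC B_Nr -B_inv_swap hf B0l.
have hk1 : ht k = 1 by case: hk => _; lia.
have [z' hz'] := W_pospair hz hk z0.
have [i [c [_ ez _]]] := pospair_ht1 hz' hk1.
have := hf i; rewrite ez brZr brC br_ef eqxx => /eqP.
rewrite scaler_eq0 => /orP[/eqP ->|]; first by rewrite scale0r B0l.
rewrite oppr_eq0 -iota0 => /eqP/iota_inj hc.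
have := @coroot_free (fun j => (j == i)%:R).
rewrite (bigD1 i) //= eqxx scale1r hc add0r big1 => [/(_ erefl i)/eqP|j /negPf ->].
  by rewrite eqxx oner_eq0.
by rewrite scale0r.
Qed.

(* [a] lowers and [b] raises the [h]-eigenvalue up to a global sign: both
   [(e i, f i)] and [(f i, e i)] are of this form with step [-2]. *)
Lemma sl2_iter (a b h v : V) (m : K) s : br a b = h -> br h b = - 2 *: b ->
  br h v = m *: v -> br a v = 0 ->
  br a (iter s.+1 (br b) v) = (s.+1%:R * (m - s%:R)) *: iter s (br b) v.
Proof.
move=> hab hb hv av.
have hiter r : br h (iter r (br b) v) = (m - 2 * r%:R) *: iter r (br b) v.
  elim: r => [|r IH]; first by rewrite mulr0 subr0.
  rewrite iterS jacobi IH hb brZl brZr -scalerDl; congr (_ *: _).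
  by rewrite -[in RHS]natr1; ring.
elim: s => [|s IH]; first by rewrite /= jacobi hab av br0r addr0 hv mul1r subr0.
rewrite iterS jacobi hab hiter IH brZr -iterS -scalerDl; congr (_ *: _).
by rewrite -[in RHS](natr1 s.+1) -!natr1; ring.
Qed.

Lemma A_diag i : A i i = 2. Proof. by case: A_GCM => h _; rewrite h. Qed.

Lemma br_coroot_e i j : br (iota (coroot i)) (e j) = (A i j)%:~R *: e j.
Proof. by rewrite br_he alpha_coroot. Qed.

(** With s = -a_ij, the vector (ad e_i)^(s+1) e_j is killed by every f_k. For k = i the sl2 factor s
    - s vanishes. Otherwise f_k moves inside, and only k = j leaves a term, (ad e_i)^(s+1) applied
    to a coroot: it is zero for s > 0 because (ad e_i)^2 kills h, and for s = 0 because a_ji = 0 as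
    well. *)
Lemma serre i j : i != j -> exists s, iter s (br (e i)) (e j) = 0.
Proof.
move=> ij; have [s hs] : exists s : nat, A i j = - s%:Z.
  by case: A_GCM => _ [/(_ i j ij) h _]; exists `|A i j|%N; lia.
have hfi : br (f i) (e j) = 0 by rewrite brC br_ef eq_sym (negPf ij) oppr0.
have hW r : W (simple_wt i *+ r + simple_wt j) (iter r (br (e i)) (e j)).
  elim: r => [|r IH]; first by rewrite mulr0n add0r; apply: W_e.
  by rewrite iterS mulrS -addrA; apply: W_br (W_e i) IH.
have hiota t r : iter r.+2 (br (e i)) (iota t) = 0.
  elim: r => [|r IH]; last by rewrite iterS IH br0r.
  by rewrite /= brC [br (e i) (iota t)]brC br_he brNl brZl brxx scaler0 oppr0 oppr0.
exists s.+1; apply: (f_killed_eq0 (hW s.+1)).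
  split=> [l|].
    by rewrite mxE mulmxnE !mxE eqxx addr_ge0 ?mulrn_wge0 //=; case: (_ == _).
  by rewrite htD htMn !ht_simple; lia.
move=> k; have [->|ki] := eqVneq k i.
  have := @sl2_iter (f i) (e i) (- iota (coroot i)) (e j) (s%:R) s.
  rewrite subrr mulr0 scale0r; apply; rewrite // ?brNl.
  - by rewrite brC br_ef eqxx.
  - by rewrite br_coroot_e A_diag scaleNr.
  - by rewrite br_coroot_e hs rmorphN scaleNr opprK.
have comm r x : br (f k) (iter r (br (e i)) x) = iter r (br (e i)) (br (f k) x).
  elim: r => //= r IH; rewrite jacobi IH [br (f k) (e i)]brC br_ef eq_sym (negPf ki) oppr0.
  by rewrite br0l add0r.
rewrite comm [br (f k) (e j)]brC br_ef eq_sym; case: eqP => [kj|_]; last first.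
  by rewrite oppr0; elim: (s.+1) => //= r ->; rewrite br0r.
case: s hs {hW} => [|s] hs; last first.
  have -> : - iota (coroot j) = iota (- coroot j) by rewrite iotaN.
  exact: hiota.
rewrite /= brNr brC opprK br_coroot_e.
case: A_GCM => _ [_ /(_ i j)[-> //]]; by rewrite scale0r.
Qed.

Definition e_nilpotent i x := exists s, iter s (br (e i)) x = 0.

Lemma iter_br0 s y : iter s (br y) 0 = 0.
Proof. by elim: s => //= s ->; rewrite br0r. Qed.

Lemma iter_brD s y u v : iter s (br y) (u + v) = iter s (br y) u + iter s (br y) v.
Proof. by elim: s => //= s ->; rewrite brDr. Qed.

Lemma iter_brZ s y c v : iter s (br y) (c *: v) = c *: iter s (br y) v.
Proof. by elim: s => //= s ->; rewrite brZr. Qed.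

(** The Leibniz rule without binomials: each application of the derivation ad y lowers [p] or [q] by
    one. *)
Lemma iter_br_br p q y u v : iter p (br y) u = 0 -> iter q (br y) v = 0 ->
  iter (p + q) (br y) (br u v) = 0.
Proof.
have [m] := ubnP (p + q)%N; elim: m p q u v => // m IH [|p] [|q] u v hm hu hv.
- by rewrite [u]hu br0l iter_br0.
- by rewrite [u]hu br0l iter_br0.
- by rewrite [v]hv br0r iter_br0.
have h1 : iter (p + q.+1) (br y) (br (br y u) v) = 0.
  by apply: IH; rewrite -?iterSr //; lia.
have h2 : iter (p + q.+1) (br y) (br u (br y v)) = 0.
  by rewrite -addSnnS; apply: IH; rewrite -?iterSr //; lia.
by rewrite addSn iterSr jacobi iter_brD h1 h2 addr0.
Qed.

Lemma e_loc_nilpotent i x : e_nilpotent i x.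
Proof.
apply: generated => [|u v [p hp] [q hq]|t|j|j].
- split=> [|c u v [p hp] [q hq]]; first by exists 0%N.
  exists (p + q)%N; rewrite iter_brD iter_brZ {1}addnC !iterD hp hq.
  by rewrite !iter_br0 scaler0 addr0.
- by exists (p + q)%N; apply: iter_br_br.
- by exists 2%N; rewrite /= [br (e i) (iota t)]brC br_he brNr brZr brxx scaler0 oppr0.
- have [->|ij] := eqVneq i j; first by exists 1%N; rewrite /= brxx.
  exact: serre.
- have [->|ij] := eqVneq i j; last by exists 1%N; rewrite /= br_ef (negPf ij).
  exists 3%N; rewrite /= br_ef eqxx [br (e j) (iota _)]brC br_he.
  by rewrite brNr brZr brxx scaler0 oppr0.
Qed.

(** Climb with [e i] to the top of the string, [s] steps up, then come down [s + m] steps with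
    [f i]. The top has coroot eigenvalue m + 2s, so no iterate vanishes before step m + 2s + 1. *)
Lemma reflection k x i (m : nat) : W k x -> x != 0 -> wt k (coroot i) = m%:R ->
  exists2 y, W (k - simple_wt i *+ m) y & y != 0.
Proof.
move=> hx x0 hm.
have ex_nil : exists s, iter s (br (e i)) x == 0 by have [s /eqP] := e_loc_nilpotent i x; exists s.
case: (ex_minnP ex_nil) => [[|s]] hs smin; first by rewrite (negPf x0) in hs.
set v := iter s (br (e i)) x.
have v0 : v != 0 by apply/negP => /smin; rewrite ltnn.
have ev : br (e i) v = 0 by apply/eqP.
have hWv r : W (k + simple_wt i *+ r) (iter r (br (e i)) x).
  elim: r => [|r IH]; first by rewrite mulr0n addr0.
  by rewrite mulrS addrCA; apply: W_br (W_e i) IH.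
have hWf r : W (k + simple_wt i *+ s - simple_wt i *+ r) (iter r (br (f i)) v).
  elim: r => [|r IH]; first by rewrite mulr0n subr0; apply: hWv.
  by rewrite mulrS opprD addrCA; apply: W_br (W_f i) IH.
have wt_simple_mul r : wt (simple_wt i *+ r) (coroot i) = 2 * r%:R.
  elim: r => [|r IH]; first by rewrite mulr0n wt0 mulr0.
  by rewrite mulrS wtD IH wt_simple alpha_coroot A_diag -natr1; ring.
have nz r : (r <= m + 2 * s)%N -> iter r (br (f i)) v != 0.
  elim: r => // r IH hr; apply/negP => /eqP h.
  have /eqP : br (e i) (iter r.+1 (br (f i)) v)
      = (r.+1%:R * (m%:R + 2 * s%:R - r%:R)) *: iter r (br (f i)) v.
    apply: (@sl2_iter _ _ (iota (coroot i))) => //.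
    - by rewrite br_ef eqxx.
    - by rewrite br_hf alpha_coroot A_diag.
    - by rewrite (hWv s) wtD hm wt_simple_mul.
  rewrite h br0r.
  rewrite eq_sym scaler_eq0 (negPf (IH (ltnW hr))) orbF mulf_eq0 pnatr_eq0 /= subr_eq0.
  by rewrite -natrM -natrD eqr_nat => /eqP; lia.
exists (iter (s + m) (br (f i)) v); last by apply: nz; lia.
have -> : k - simple_wt i *+ m = k + simple_wt i *+ s - simple_wt i *+ (s + m).
  by rewrite mulrnDr opprD addrA addrK.
exact: hWf.
Qed.

(** * The Casimir scalar and the cobracket *)

(** Twice (rho|k), where rho enters only through (rho|alpha_i) = (alpha_i|alpha_i)/2 = 1/eps_i. *)
Definition rho2 (k : weight) : K := \sum_i (k 0 i)%:~R * (2 / eps i).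

(* The scalar 2(rho|k) - (k|k), the eigenvalue of the truncated Casimir
   operator on the weight space of [k]. *)
Definition casimir k := rho2 k - sform k k.

Lemma rho2D k l : rho2 (k + l) = rho2 k + rho2 l.
Proof. by rewrite /rho2 -big_split; apply: eq_bigr => i _; rewrite mxE intrD mulrDl. Qed.

Lemma rho2_simple i : rho2 (simple_wt i) = 2 / eps i.
Proof.
rewrite /rho2 (bigD1 i) //= big1 => [|j ji]; first by rewrite mxE !eqxx addr0 mul1r.
by rewrite mxE (negPf ji) andbF mul0r.
Qed.

Lemma sform_simple_simple i : sform (simple_wt i) (simple_wt i) = 2 / eps i.
Proof. by rewrite sform_simple wt_simple alpha_coroot A_diag. Qed.

Lemma casimir_simpleD i k :
  casimir (simple_wt i + k) = casimir k - 2 * sform (simple_wt i) k.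
Proof.
rewrite /casimir rho2D rho2_simple sformDl !sformDr sform_simple_simple.
by rewrite (sformC k (simple_wt i)); ring.
Qed.

Lemma casimir_simple i : casimir (simple_wt i) = 0.
Proof. by rewrite /casimir rho2_simple sform_simple_simple subrr. Qed.

(** The reflection preserves (k|k) and changes 2(rho|k) by 2m(rho|alpha_i). The proof adds alpha_i
    one at a time; the resulting quadratic in [r] is evaluated at [r = m]. *)
Lemma casimir_reflection k i (m : nat) : wt k (coroot i) = m%:R ->
  casimir k = casimir (k - simple_wt i *+ m) + 2 * m%:R / eps i.
Proof.
move=> hm; have ei : eps i != 0 by rewrite gt_eqF.
set l := k - _; have -> : k = simple_wt i *+ m + l by rewrite /l addrC subrK.
have hl : sform (simple_wt i) l = - m%:R / eps i.
  rewrite sformC /l sformDl sformNl sform_simple hm.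
  have -> : sform (simple_wt i *+ m) (simple_wt i) = m%:R * (2 / eps i).
    elim: m {hm l} => [|m IH]; first by rewrite mulr0n mul0r /sform wt0.
    by rewrite mulrS sformDl IH sform_simple_simple -natr1; ring.
  by field.
have step r : casimir (simple_wt i *+ r + l)
    = casimir l + (2 * r%:R * (m%:R - r%:R + 1)) / eps i.
  elim: r => [|r IH]; first by rewrite mulr0n add0r mulr0 mul0r mul0r addr0.
  have hr : sform (simple_wt i) (simple_wt i *+ r) = r%:R * (2 / eps i).
    elim: r {IH} => [|r IH]; first by rewrite mulr0n mul0r sformC /sform wt0.
    by rewrite mulrS sformDr IH sform_simple_simple -natr1; ring.
  rewrite mulrS -addrA casimir_simpleD IH sformDr hl hr -natr1.
  by field.
by rewrite step; congr (_ + _); ring.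
Qed.

(** Over a single simple root a bracket step can only form the bracket of [e i] with a multiple of
    itself, which is zero. *)
Lemma pospair_support i k x x' : pospair k x x' ->
  (forall j, j != i -> k 0 j = 0) -> exists c, x = c *: e i.
Proof.
elim => {k x x'} [j|k c x x' y y' _ IH1 _ IH2|k j x x' hx IH] hk.
- have [->|ji] := eqVneq j i; first by exists 1; rewrite scale1r.
  by have := hk _ ji; rewrite mxE !eqxx.
- have [a ->] := IH1 hk; have [b ->] := IH2 hk; exists (c * a + b).
  by rewrite scalerA scalerDl.
- have [k_ge0 _] := pospair_pos hx.
  have ji : j = i.
    apply/eqP; apply: contraT => /hk; rewrite !mxE !eqxx /=.
    by have := k_ge0 j; lia.
  have [|a ->] := IH; last by exists 0; rewrite ji brZr brxx scaler0 scale0r.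
  by move=> l li; have := hk _ li; rewrite !mxE ji (negPf li) andbF add0r.
Qed.

Lemma pos_support k x i : W k x -> x != 0 -> pos k -> 1 < ht k ->
  exists2 j, j != i & 0 < k 0 j.
Proof.
move=> hx x0 hk k1; have [x' hx'] := W_pospair hx hk x0.
apply/exists2P; apply: contrapT => h.
have [|c xc] := pospair_support (i := i) hx'.
  move=> j ji; apply/eqP; case: hk => /(_ j); rewrite le_eqVlt => /orP[/eqP <- //|hj _].
  by case: h; exists j.
have := W_uniq hx (_ : W (simple_wt i) x) x0; rewrite {1}xc => /(_ (WZ c (@W_e i))) ki.
by rewrite ki ht_simple ltxx in k1.
Qed.

Lemma wt_corootE k i : wt k (coroot i) = (\sum_j k 0 j * A i j)%:~R.
Proof. by rewrite /wt rmorph_sum; apply: eq_bigr => j _; rewrite alpha_coroot -intrM. Qed.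

(** If a coroot pairs positively with [k], reflecting lowers both the height and the scalar; the
    reflected weight may be simple, so the induction carries the weak inequality as well. If no
    coroot does, then (k|k) <= 0 while the rho term is positive. *)
Lemma casimir_ge0 k x : W k x -> x != 0 -> pos k ->
  0 <= casimir k /\ (1 < ht k -> 0 < casimir k).
Proof.
have [N] := ubnP `|ht k|%N; elim: N k x => // N IH k x hN hx x0 hk.
have [k1|k1] := ltP 1 (ht k); last first.
  have k1' : ht k = 1 by case: hk => _; lia.
  have [x' hx'] := W_pospair hx hk x0; have [i [_ [-> _ _]]] := pospair_ht1 hx' k1'.
  by rewrite casimir_simple.
suff h : 0 < casimir k by split=> //; apply: ltW.
have [/existsP[i hi]|/existsPn hm] := boolP [exists i, 0 < \sum_j k 0 j * A i j].
  have [m hm] : exists m : nat, \sum_j k 0 j * A i j = m%:Z.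
    by case: (\sum_j _) hi => // m _; exists m.
  have hwt : wt k (coroot i) = m%:R by rewrite wt_corootE hm.
  have [y hy y0] := reflection hx x0 hwt.
  set l := k - _ in hy.
  have hl : ht l = ht k - m%:Z by rewrite /l htD htN htMn ht_simple; lia.
  (* A positive coordinate other than the [i]-th is untouched by the reflection, so the new weight
     cannot be negative. *)
  have [j ji kj] := pos_support i hx x0 hk k1.
  have lj : l 0 j = k 0 j by rewrite /l !mxE mulmxnE mxE (negPf ji) andbF mul0rn subr0.
  have l0 : l != 0 by apply/eqP => l0; rewrite l0 mxE in lj; rewrite -lj ltxx in kj.
  have [y' hy'] := W_wtpair hy l0 y0.
  have hlp : pos l.
    case: (wtpair_pos hy' l0) => // -[/(_ j)]; rewrite mxE lj oppr_ge0 => /(lt_le_trans kj).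
    by rewrite ltxx.
  have [] := IH l y _ hy y0 hlp; first by case: hlp => _; lia.
  move=> h _; rewrite (casimir_reflection hwt) ltr_wpDl // divr_gt0 // mulr_gt0 // ltr0n; lia.
rewrite /casimir subr_gt0; apply: (@le_lt_trans _ _ 0).
  rewrite sformE -oppr_ge0 -sumrN; apply: sumr_ge0 => i _.
  rewrite -mulrN mulr_ge0 //; last by rewrite wt_corootE oppr_ge0 lerz0; have := hm i; lia.
  by rewrite divr_ge0 // ?ler0z; [case: hk|apply: ltW].
have k0 i : 0 <= (k 0 i)%:~R * (2 / eps i).
  by rewrite mulr_ge0 ?ler0z ?divr_ge0 //; [case: hk|apply: ltW].
rewrite lt_def sumr_ge0 // andbT; apply/eqP => /eqP; rewrite psumr_eq0 // => /allP h.
have : ht k = 0.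
  rewrite /ht big1 // => i _; have := h i (mem_index_enum i).
  by rewrite /= mulf_eq0 intr_eq0 orbC gt_eqF ?divr_gt0 // => /eqP.
by move=> hk0; rewrite hk0 in k1.
Qed.

Lemma B_ht k l x y : W k x -> W l y -> ht k + ht l != 0 -> B x y = 0.
Proof. by move=> hx hy; rewrite -htD => h; apply: B_wt hx hy _; apply: contraNneq h => ->; rewrite ht0. Qed.

Lemma pos_neq0 k : pos k -> k != 0.
Proof. by move=> hk; apply/eqP => k0; move: hk; rewrite k0 => /pos0. Qed.

Local Notation tensor := (seq ((weight * (V * V)) * (weight * (V * V)))).

(* [L] represents the tensor sum of the [u (x) v], the cobracket of [x]: it is
   dual to the bracket under the invariant form, and its bracket is the
   Casimir operator applied to [x]. *)
Definition cobracket k x (L : tensor) :=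
  [/\ forall p, p \in L -> [/\ pospair p.1.1 p.1.2.1 p.1.2.2,
        pospair p.2.1 p.2.2.1 p.2.2.2 & p.1.1 + p.2.1 = k],
      forall l q, pos l -> ht l < ht k -> W (- l) q ->
        br q x = \sum_(p <- L) B q p.1.2.1 *: p.2.2.1
    & \sum_(p <- L) br p.1.2.1 p.2.2.1 = casimir k *: x].

Lemma cobracket_lin k c x y L1 L2 : cobracket k x L1 -> cobracket k y L2 ->
  cobracket k (c *: x + y)
    ([seq ((p.1.1, (c *: p.1.2.1, c^* *: p.1.2.2)), p.2) | p <- L1] ++ L2).
Proof.
move=> [a1 b1 c1] [a2 b2 c2]; split=> [p|l q hl lk hq|].
- rewrite mem_cat => /orP[/mapP[p' /a1[h1 h2 h3] ->]|/a2 //] /=; split=> //.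
  exact: pospairZ.
- rewrite big_cat big_map /= brDr brZr (b1 l) // (b2 l) //; congr (_ + _).
  by rewrite scaler_sumr; apply: eq_bigr => p _; rewrite B_Zr scalerA.
- rewrite big_cat big_map /= scalerDr c2; congr (_ + _).
  rewrite scalerA mulrC -scalerA -c1 scaler_sumr.
  by apply: eq_bigr => p _; rewrite brZl.
Qed.

Lemma cobracket_simple i : cobracket (simple_wt i) (e i) [::].
Proof.
split=> [//|l q [_ l0] hl|]; first by rewrite ht_simple in hl; lia.
by rewrite big_nil casimir_simple scale0r.
Qed.

(** The scalar term arises only when [q] has height -1: then [q, e_i] lies in the Cartan subalgebra
    and acts on [y] through its weight. Otherwise duality for [y] applies to [q, e_i]. *)
Lemma br_e_dual k i l q y (L : tensor) : W k y -> cobracket k y L ->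
  pos l -> ht l < 1 + ht k -> W (- l) q ->
  br (br q (e i)) y = \sum_(p <- L) B q (br (e i) p.1.2.1) *: p.2.2.1
    + (- sform (simple_wt i) k * B q (e i)) *: y.
Proof.
move=> hy [hL hdual _] hl lk hq; have [->|q0] := eqVneq q 0.
  by rewrite !br0l B0l mulr0 scale0r addr0 big1 // => p _; rewrite B0l scale0r.
have nl0 : - l != 0 by rewrite oppr_eq0 pos_neq0.
have qpair : exists q', pospair l q' q.
  have [q' [/pospair_pos/(pos_opp hl)//|[|[/eqP]]]] := W_wtpair hq nl0 q0.
    by rewrite opprK; exists q'.
  by rewrite (negPf nl0).
under eq_bigr => p _ do rewrite -B_inv.
have [l1|l1] := ltP 1 (ht l).
  have -> : B q (e i) = 0.
    by apply: B_ht hq (W_e i) _; rewrite htN ht_simple; lia.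
  rewrite mulr0 scale0r addr0.
  have hqe : W (- (l - simple_wt i)) (br q (e i)).
    by rewrite opprB addrC; apply: W_br hq (W_e i).
  have [->|qe0] := eqVneq (br q (e i)) 0.
    by rewrite br0l big1 // => p _; rewrite B0l scale0r.
  have hle : ht (l - simple_wt i) = ht l - 1 by rewrite htD htN ht_simple.
  have le0 : - (l - simple_wt i) != 0.
    by apply/eqP => /(congr1 ht); rewrite htN hle ht0; lia.
  apply: hdual => //; last by lia.
  have [w /wtpair_pos/(_ le0)[[_]|]] := W_wtpair hqe le0 qe0; last by rewrite opprK.
  by rewrite htN hle; lia.
have [q' hq'] := qpair.
have [|j [c [_ _ ->]]] := pospair_ht1 hq'; first by case: hl => _; lia.
have -> : br (c^* *: f j) (e i) = - (if i == j then c^* else 0) *: iota (coroot i).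
  by rewrite brZl brC br_ef; case: eqP => _; rewrite ?scaleNr ?scale0r -?scalerN ?oppr0 ?scaler0.
rewrite brZl hy big_seq big1 ?add0r => [|p /hL[hpp _ _]]; last have [hp _] := pospair_W hpp.
  rewrite scalerA B_Zl BC B_ef sformC sform_simple; case: eqP => [_|_].
    by congr (_ *: _); field; rewrite gt_eqF.
  by rewrite mulr0 mulr0 oppr0 mul0r.
rewrite B_Zl (B_wt (W_iota _) hp) ?mulr0 ?scale0r // add0r.
exact: pos_neq0 (pospair_pos hpp).
Qed.

(** Here the scalar term arises only for [l = k], just outside the range of duality for [y]: then
    [q, y] is a multiple of [nu k]. *)
Lemma br_dual_e k i l q y (L : tensor) : pos k -> W k y -> cobracket k y L ->
  pos l -> ht l < 1 + ht k -> W (- l) q ->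
  br (e i) (br q y) = \sum_(p <- L) B q p.1.2.1 *: br (e i) p.2.2.1
    + (sform (simple_wt i) k * B q y) *: e i.
Proof.
move=> [_ hk] hy [hL hdual _] hl lk hq.
have [l1|l1] := ltP (ht l) (ht k).
  rewrite (B_ht hq hy) ?mulr0 ?scale0r ?addr0; last by rewrite htN; lia.
  by rewrite (hdual l) // br_sumr; apply: eq_bigr => p _; rewrite brZr.
rewrite big_seq big1 ?add0r => [|p /hL[h1 h2 h3]]; last first.
  rewrite (B_ht hq (proj1 (pospair_W h1))) ?scale0r // htN.
  have := congr1 ht h3; rewrite htD.
  by case: (pospair_pos h1) (pospair_pos h2) => [_ ?] [_ ?]; lia.
have [kl|kl] := eqVneq l k.
  rewrite kl in hq; rewrite [br q y]brC brNr (br_oppE hy hq) brZr [br (e i) _]brC W_e.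
  by rewrite scalerN opprK scalerA mulrC BC.
rewrite (B_wt hq hy) ?mulr0 ?scale0r; last by rewrite addrC subr_eq0 eq_sym.
suff -> : br q y = 0 by rewrite br0r.
apply/eqP/negP => /negP h.
have := W_ht (W_br hq hy) h; rewrite htD htN => /(_ _)/eqP; apply; last by lia.
by rewrite addrC subr_eq0 eq_sym.
Qed.

(** Let [e i] act on both tensor factors and add [lam] times e_i (x) y - y (x) e_i. The value of
    [lam] absorbs the scalar terms of [br_e_dual] and [br_dual_e]; the added part has bracket 2
    [lam] [e_i, y], which is exactly the change of the Casimir scalar. *)
Lemma cobracket_br k i y y' L : pospair k y y' -> cobracket k y L ->
  exists L', cobracket (simple_wt i + k) (br (e i) y) L'.
Proof.
move=> hyp hL; have [hy hy'] := pospair_W hyp; have hk := pospair_pos hyp.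
pose lam := - sform (simple_wt i) k.
exists ([seq ((simple_wt i + p.1.1, (br (e i) p.1.2.1, br p.1.2.2 (f i))), p.2) | p <- L]
  ++ [seq (p.1, (simple_wt i + p.2.1, (br (e i) p.2.2.1, br p.2.2.2 (f i)))) | p <- L]
  ++ [:: ((simple_wt i, (lam *: e i, lam^* *: f i)), (k, (y, y')));
         ((k, (- lam *: y, (- lam)^* *: y')), (simple_wt i, (e i, f i)))]).
have [h1 h2 h3] := hL; split=> [p|l q hl lk hq|].
- rewrite !mem_cat !inE => /orP[/mapP[p' /h1[ha hb hc] ->]|
    /orP[/mapP[p' /h1[ha hb hc] ->]|/orP[] /eqP ->]] /=; split=> //.
  + exact: pospair_br.
  + by rewrite -hc addrA.
  + exact: pospair_br.
  + by rewrite -hc addrCA.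
  + by apply: pospairZ; apply: pospair_gen.
  + exact: pospairZ.
  + exact: pospair_gen.
  + by rewrite addrC.
- have lk' : ht l < 1 + ht k by rewrite htD ht_simple in lk.
  rewrite jacobi (br_e_dual i hy hL hl lk' hq) (br_dual_e i hk hy hL hl lk' hq).
  rewrite !big_cat !big_map !big_cons big_nil /= addr0 !B_Zr [LHS]addrACA [RHS]addrA.
  by rewrite /lam opprK.
- rewrite !big_cat !big_map !big_cons big_nil /= addr0 !brZl.
  rewrite [br y (e i)]brC scalerN -scaleNr opprK -scalerDl addrA -big_split /=.
  under eq_bigr => p _ do rewrite -jacobi.
  rewrite -br_sumr h3 brZr -scalerDl casimir_simpleD /lam; congr (_ *: _); ring.
Qed.

Lemma exists_cobracket k x x' : pospair k x x' -> exists L, cobracket k x L.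
Proof.
elim => {k x x'} [i|k c x x' y y' _ [L1 h1] _ [L2 h2]|k i x x' hx [L hL]].
- by exists [::]; apply: cobracket_simple.
- by eexists; apply: cobracket_lin h1 h2.
- exact: cobracket_br hx hL.
Qed.

(** * Positivity *)

Definition psd_upto N :=
  forall k x x', ht k < N -> pospair k x x' -> 0 <= B x' x.

(** Distinct weights are orthogonal, and entries of equal weight add up to a single pair of that
    weight. *)
Lemma psd_sum N (L : seq (weight * (V * V))) : psd_upto N ->
  (forall p, p \in L -> ht p.1 < N /\ pospair p.1 p.2.1 p.2.2) ->
  0 <= B (\sum_(p <- L) p.2.2) (\sum_(p <- L) p.2.1).
Proof.
move=> psd hL.
pose X l := \sum_(p <- L | p.1 == l) p.2.1; pose X' l := \sum_(p <- L | p.1 == l) p.2.2.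
pose s := undup (map fst L).
have group (F : V * V -> V) : \sum_(p <- L) F p.2 = \sum_(l <- s) \sum_(p <- L | p.1 == l) F p.2.
  have := sum_group [seq (p.1, F p.2) | p <- L]; rewrite -map_comp !big_map => ->.
  by apply: eq_bigr => l _; rewrite big_map.
have -> : \sum_(p <- L) p.2.1 = \sum_(l <- s) X l by apply: (group fst).
have -> : \sum_(p <- L) p.2.2 = \sum_(l <- s) X' l by apply: (group snd).
rewrite B_sumr big_seq; apply: sumr_ge0 => l ls.
have hX k : k \in s -> ht k < N /\ pospair k (X k) (X' k).
  rewrite mem_undup => /mapP[p0 /hL[hp0 hp] ->]; split=> //; rewrite /X /X'.
  elim: (L) hL => [|p L' IH] hL'; first by rewrite !big_nil; apply: pospair0 hp.
  have {}IH := IH (fun q hq => hL' q (mem_behead (s := p :: L') hq)).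
  rewrite !big_cons; case: eqP => // pk.
  have [_ h] := hL' _ (mem_head _ _); rewrite pk in h.
  by have := pospair_lin 1 h IH; rewrite rmorph1 !scale1r.
rewrite B_suml (bigD1_seq l) ?undup_uniq //= big1_seq ?addr0; last first.
  move=> k /andP[kl ks]; have [_ hk] := hX k ks; have [_ hl] := hX l ls.
  have [_ {}hk] := pospair_W hk; have [{}hl _] := pospair_W hl.
  by apply: B_wt hk hl _; rewrite addrC subr_eq0 eq_sym.
by have [hl1 hl2] := hX l ls; apply: psd hl1 hl2.
Qed.

Lemma pospair_adjpair k x x' : pospair k x x' -> adjpair x x'.
Proof. by move=> h; apply: (@adjpair_wt k); left. Qed.

Lemma gram_psd N m (w : 'I_m -> weight) (u u' : 'I_m -> V) : psd_upto N ->
  (forall i, ht (w i) < N /\ pospair (w i) (u i) (u' i)) ->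
  forall c : 'I_m -> K, 0 <= \sum_i \sum_j (c i)^* * c j * B (u' i) (u j).
Proof.
move=> psd hw c.
pose L := [seq (w i, (c i *: u i, (c i)^* *: u' i)) | i <- index_enum 'I_m].
have -> : \sum_i \sum_j (c i)^* * c j * B (u' i) (u j)
    = B (\sum_(p <- L) p.2.2) (\sum_(p <- L) p.2.1).
  rewrite !big_map B_suml; apply: eq_bigr => i _; rewrite B_sumr.
  by apply: eq_bigr => j _; rewrite /= B_Zl B_Zr mulrA.
apply: psd_sum psd _ => _ /mapP[i _ ->] /=; have [h1 h2] := hw i; split=> //.
exact: pospairZ.
Qed.

(** Invariance turns each term into B(v', [u', x]), and duality with q = u' expands [u', x]. *)
Lemma cobracket_gram k x x' L : pospair k x x' -> cobracket k x L ->
  B (\sum_(p <- L) br p.2.2.2 p.1.2.2) x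
  = \sum_(p <- L) \sum_(r <- L) B p.1.2.2 r.1.2.1 * B p.2.2.2 r.2.2.1.
Proof.
move=> hx [hL hdual _]; rewrite B_suml; apply: eq_big_seq => p /hL[h1 h2 h3].
have [_ hq] := pospair_W h1; have hp1 := pospair_pos h1; have hp2 := pospair_pos h2.
rewrite B_inv (hdual p.1.1) //; last by rewrite -h3 htD; case: hp2 => _; lia.
by rewrite B_sumr; apply: eq_bigr => r _; rewrite B_Zr.
Qed.

Lemma adjpair_cobracket k x L : cobracket k x L ->
  adjpair (casimir k *: x) (\sum_(p <- L) br p.2.2.2 p.1.2.2).
Proof.
move=> [hL _ <-]; elim: L hL => [|p L IH] hL; first by rewrite !big_nil; apply: sums0.
rewrite !big_cons; have [h1 h2 _] := hL _ (mem_head _ _).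
apply: sumsD; first by apply: adjpair_br; apply: pospair_adjpair; eassumption.
by apply: IH => q hq; have := hL q (mem_behead (s := p :: L) hq).
Qed.

Lemma pospair_ge0 k x x' : pospair k x x' -> 0 <= B x' x.
Proof.
have [N] := ubnP `|ht k|%N; elim: N k x x' => // N IH k x x' hN hx.
have psd : psd_upto (ht k).
  move=> l y y' hl hy; apply: (IH l) => //; have [_ hl0] := pospair_pos hy.
  by lia.
have hk := pospair_pos hx; have [hWx hWx'] := pospair_W hx.
have [x0|x0] := eqVneq x 0; first by rewrite x0 B0r.
have [k1|k1] := ltP 1 (ht k); last first.
  have [|i [c [_ -> ->]]] := pospair_ht1 hx; first by case: hk => _; lia.
  rewrite B_Zl B_Zr mulrA mulrC BC B_ef eqxx mulr_ge0 ?mul_conjC_ge0 //; first exact: ltW.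
  by rewrite mulrC mul_conjC_ge0.
have [_ /(_ k1) hc] := casimir_ge0 hWx x0 hk.
have [L hL] := exists_cobracket hx.
(* Hermitian symmetry identifies the Gram sum of the cobracket with the conjugate of c(k) B(x,
   x'). *)
have hz := adjpair_hermitian (adjpair_cobracket hL) (pospair_adjpair hx).
rewrite B_Zl (cobracket_gram hx hL) in hz.
rewrite BC -(pmulr_rge0 _ hc) -conjC_ge0 -hz.
have [hLp _ _] := hL; pose T := in_tuple L.
have memT i : tnth T i \in L by rewrite mem_tnth.
rewrite big_tnth; under eq_bigr => i _ do rewrite big_tnth.
pose G := \matrix_(i, j) B (tnth T i).1.2.2 (tnth T j).1.2.1.
pose H := \matrix_(i, j) B (tnth T i).2.2.2 (tnth T j).2.2.1.
(* The Gram matrices are indexed by positions in [L]. Both tensor factors have positive weights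
   summing to [k], hence smaller height, so the induction hypothesis makes both matrices
   semidefinite. *)
have := @schur_sum_ge0 K (size L) G H.
under [X in _ -> _ -> _ -> is_true (0 <= X)]eq_bigr => i _ do
  under eq_bigr => j _ do rewrite !mxE.
apply.
- move=> c; under eq_bigr => i _ do under eq_bigr => j _ do rewrite mxE.
  apply: (gram_psd (N := ht k) (w := fun i => (tnth T i).1.1)) => // i.
  have [h1 h2 h3] := hLp _ (memT i); split=> //.
  by rewrite -h3 htD ltrDl; case: (pospair_pos h2).
- move=> c; under eq_bigr => i _ do under eq_bigr => j _ do rewrite mxE.
  apply: (gram_psd (N := ht k) (w := fun i => (tnth T i).2.1)) => // i.
  have [h1 h2 h3] := hLp _ (memT i); split=> //.
  by rewrite -h3 htD ltrDr; case: (pospair_pos h1).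
- move=> i j; rewrite !mxE.
  have [_ hi _] := hLp _ (memT i); have [_ hj _] := hLp _ (memT j).
  by rewrite (adjpair_hermitian (pospair_adjpair hj) (pospair_adjpair hi)) BC.
Qed.

Lemma wtpair_ge0 k x x' : k != 0 -> wtpair k x x' -> 0 <= B x x'.
Proof.
move=> k0 [/pospair_ge0|[/pospair_ge0//|[k1]]]; first by rewrite BC.
by rewrite k1 eqxx in k0.
Qed.

(** A null vector of a semidefinite Hermitian form is orthogonal to everything, and every nonzero
    vector of the opposite weight space is the image of some vector of weight [k]; nondegeneracy
    concludes. *)
Lemma wtpair_eq0 k x x' : k != 0 -> wtpair k x x' -> B x x' = 0 -> x = 0.
Proof.
move=> k0 hx hxx; have [hWx _] := wtpair_W hx.
apply: (B_nondeg_wt hWx) => z hz; have [->|z0] := eqVneq z 0; first by rewrite B0r.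
have nk0 : - k != 0 by rewrite oppr_eq0.
have [z' hz'] := W_wtpair hz nk0 z0; have := wtpair_sym hz'; rewrite opprK => hzz.
apply/eqP; apply: contraT => b0; set b := B x z in b0 *.
have s_ge0 : 0 <= B z' z by apply: wtpair_ge0 hzz.
set s := B z' z in s_ge0; have sK : s^* = s by apply/CrealP/ger0_real.
(* This makes c b real with 2 c b + s = -1, which is the value of the form at [c *: x + z']. *)
pose c := - (s + 1) / (2 * b).
have cb : c * b = - (s + 1) / 2 by rewrite /c; field.
have hzx : B z' x' = b^*.
  have := adjpair_hermitian (adjpair_wt hzz) (adjpair_wt hx).
  by rewrite BC -/b => ->; rewrite conjCK.
have := wtpair_ge0 k0 (wtpair_lin c hx hzz).
rewrite B_linl B_Dr !B_Zr hxx mulr0 add0r B_Dr B_Zr hzx -rmorphM -/b -/s cb /=.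
have -> : (- (s + 1) / 2)^* = - (s + 1) / 2.
  by rewrite rmorphM rmorphN rmorphD rmorph1 fmorphV rmorph_nat /= sK.
have -> : - (s + 1) / 2 + (- (s + 1) / 2 + s) = - 1 by field.
by rewrite oppr_ge0 lt_geF.
Qed.

Lemma wtpair_gt0 k x x' : k != 0 -> wtpair k x x' -> x != 0 -> 0 < B x x'.
Proof.
move=> k0 hx x0; rewrite lt_def (wtpair_ge0 k0 hx) andbT.
by apply: contraNneq x0 => /(wtpair_eq0 k0 hx) ->.
Qed.

Lemma br_eq0_proportional k l x y : k != 0 -> l != 0 -> W k x -> W l y ->
  x != 0 -> y != 0 -> sform k l < 0 -> br x y = 0 -> exists c, y = c *: x.
Proof.
move=> k0 l0 hx hy x0 y0 hkl xy0.
have [x' hxx] := W_wtpair hx k0 x0; have [y' hyy] := W_wtpair hy l0 y0.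
have [_ hx'] := wtpair_W hxx; have [_ hy'] := wtpair_W hyy.
have bx := wtpair_gt0 k0 hxx x0; have by_ := wtpair_gt0 l0 hyy y0.
have key : sform k l * B x x' * B y y' = B (br x' y) (br y' x).
  have : B (br x' (br x y)) y' = 0 by rewrite xy0 br0r B0l.
  rewrite jacobi [br x' x]brC (br_oppE hx hx') brNl brZl hy B_Dl B_Nl !B_Zl.
  rewrite [B (br x _) _]B_inv_swap [br x y']brC B_Nr opprK addrC => /eqP.
  by rewrite subr_eq0 => /eqP ->; rewrite -/(sform l k) (sformC l k); ring.
have hz : adjpair (br x' y) (br y' x).
  by apply: adjpair_br; [apply/adjpair_sym|]; apply: adjpair_wt; eassumption.
have [kl|kl] := eqVneq k l; last first.
  have kl0 : - k + l != 0 by rewrite addrC subr_eq0 eq_sym.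
  have hW2 : W (- (- k + l)) (br y' x) by rewrite opprD opprK addrC; apply: W_br.
  suff : 0 <= B (br x' y) (br y' x).
    by rewrite -key pmulr_lge0 // pmulr_lge0 // => /le_lt_trans/(_ hkl); rewrite ltxx.
  have [h|[-> _]] := adjpair_component (W_br hx' hy) hW2 hz; last by rewrite B0l.
  exact: wtpair_ge0 h.
rewrite -{}kl in hy hyy hy' hkl key l0.
have hyx : B y' x = (B y x')^* by apply: (adjpair_hermitian (adjpair_wt hyy) (adjpair_wt hxx)).
set b := B y x' in hyx.
(* For equal weights both brackets in [key] lie in the Cartan subalgebra, so the right-hand side is
   (k|k) b b^* and (k|k) < 0 cancels. *)
have cs : B x x' * B y y' = b * b^*.
  apply: (mulfI (ltr0_neq0 hkl)); rewrite mulrA key.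
  rewrite [br x' y]brC (br_oppE hy hx') [br y' x]brC (br_oppE hx hy').
  rewrite B_Nl B_Nr opprK B_Zl B_Zr B_iota form_nu -/(sform k k) -/b [B x y']BC hyx.
  by ring.
set a := B x x' in bx cs; have a0 : a != 0 by rewrite gt_eqF.
have aK : a^* = a by apply/CrealP/gtr0_real.
(* Remove from [y] its projection to [x]; by [cs] the remainder has norm zero, and definiteness
   kills it. *)
have hw := wtpair_lin (- b / a) hxx hyy.
exists (b / a); apply/eqP; rewrite -subr_eq0 addrC -scaleNr -mulNr; apply/eqP.
apply: wtpair_eq0 hw _ => //.
rewrite B_linl !B_Dr !B_Zr -/a -/b [B x y']BC hyx rmorphM fmorphV rmorphN /= aK.
have -> : B y y' = b * b^* / a by rewrite -cs; field.
by field.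
Qed.
End Contravariant.

(** * From functionals on the Cartan subalgebra to integral weights, and the theorem *)

Lemma joint_eigen_wt (a : hT -> K) x : x != 0 ->
  (forall t, br (iota t) x = a t *: x) -> exists k, forall t, a t = wt k t.
Proof.
move=> x0 hx.
have [L [hL xL]] : exists L : seq (weight * V),
    (forall p, p \in L -> W p.1 p.2) /\ x = \sum_(p <- L) p.2.
  move: (x); apply: V_ind => [_ _ [L [hL ->]] [L' [hL' ->]]|k y hy].
    exists (L ++ L'); rewrite big_cat; split=> // p.
    by rewrite mem_cat => /orP[/hL|/hL'].
  by exists [:: (k, y)]; rewrite big_seq1; split=> // p; rewrite inE => /eqP ->.
rewrite sum_group in xL; set s := undup _ in xL.
pose X k := \sum_(p <- L | p.1 == k) p.2.
have hX k : W k (X k).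
  by rewrite /X big_seq_cond; apply: W_sum => p /andP[/hL + /eqP <-].
have [/hasP[k ks Xk]|/hasPn hs] := boolP (has (fun k => X k != 0) s); last first.
  move: x0; rewrite xL big1_seq ?eqxx // => k /andP[_ /hs].
  by rewrite negbK => /eqP.
(* The nonzero component [X k] is scaled by [wt k t], and by independence also by [a t]. *)
exists k => t; apply/eqP; rewrite eq_sym -subr_eq0.
have sum0 : \sum_(l <- s) (wt l t - a t) *: X l = 0.
  have := hx t; rewrite xL br_sumr scaler_sumr => /eqP; rewrite -subr_eq0 -sumrB => /eqP h.
  by rewrite -[RHS]h; apply: eq_bigr => l _; rewrite scalerBl hX.
have := W_indep (undup_uniq _) (fun l _ => WZ _ (hX l)) sum0 ks.
by move/eqP; rewrite scaler_eq0 (negPf Xk) orbF.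
Qed.

Lemma root_br_neq0 (a b : hT -> K) (ha hb : hT) x y :
  (exists t, a t != 0) -> (exists t, b t != 0) ->
  (forall t, form ha t = a t) -> (forall t, form hb t = b t) -> form ha hb < 0 ->
  x != 0 -> y != 0 -> (forall t, br (iota t) x = a t *: x) ->
  (forall t, br (iota t) y = b t *: y) -> br x y = 0 -> exists c, y = c *: x.
Proof.
move=> [t at0] [u bu0] hha hhb hab x0 y0 hx hy.
have [k ak] := joint_eigen_wt x0 hx; have [l bl] := joint_eigen_wt y0 hy.
have [B [B_lin BC B_inv B_iota]] := exists_invariant_form.
apply: (br_eq0_proportional B_lin BC B_inv B_iota (k := k) (l := l)) => //.
- by apply: contraNneq at0 => k0; rewrite ak k0 wt0.
- by apply: contraNneq bu0 => l0; rewrite bl l0 wt0.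
- by move=> v; rewrite hx ak.
- by move=> v; rewrite hy bl.
- have -> // : sform k l = form ha hb.
  have -> : ha = nu k by apply: form_inj => v; rewrite form_nu hha ak.
  have -> : hb = nu l by apply: form_inj => v; rewrite form_nu hhb bl.
  by rewrite form_nu.
Qed.
End KacMoody.

Local Open Scope complex_scope.

Theorem theorem4p4 (R : realType) (n : nat) (A : 'M[int]_n)
  (V : lmodType R[i]) (br : V -> V -> V) (hT : vectType R[i]) (iota : hT -> V)
  (alpha : 'I_n -> hT -> R[i]) (coroot : 'I_n -> hT) (e f : 'I_n -> V)
  (form : hT -> hT -> R[i]) :
  is_GCM A -> symmetrisable A ->
  is_KM_algebra A br iota alpha coroot e f ->
  standard_form_h alpha coroot form ->
  forall a b : hT -> R[i],
    is_root br iota a -> is_root br iota b ->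
    (exists c : R[i], induced_form form a b c /\ c < 0) ->
    forall x y : V, x != 0 -> y != 0 ->
      root_space br iota a x -> root_space br iota b y ->
      line x <> line y ->
      br x y != 0.
Proof.
move=> hA _ [lie [[iota_lin iota_inj] [_ alpha_lin alpha_free coroot_free alpha_coroot]
  [br_ef br_hh br_he br_hf] gen noid]] [form_lin formC form_nondeg [eps [eps0 form_coroot]]].
move=> a b [a0 _] [b0 _] [c [[ha [hb [hha [hhb hc]]]] c0]] x y x0 y0 hx hy hxy.
apply/eqP => xy0; apply: hxy.
have epsK i : 0 < ratr (eps i) :> R[i] by rewrite ltr0q.
have [|d yd] := root_br_neq0 hA lie iota_lin iota_inj alpha_lin alpha_free coroot_free
  alpha_coroot br_ef br_hh br_he br_hf gen noid form_lin formC form_nondeg epsK form_coroot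
  a0 b0 hha hhb _ x0 y0 hx hy xy0; first by rewrite hc.
(* An invertible [d] makes each line contain the other; lines are predicates, so equality follows by
   extensionality. *)
have d0 : d != 0 by apply: contraNneq y0 => d0; rewrite yd d0 scale0r.
apply/funext => v; apply/propext; split=> -[r ->]; last by exists (r * d); rewrite yd scalerA.
by exists (r / d); rewrite yd scalerA mulfVK.
Qed.
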